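(* Let $B$ be a bialgebra in $\mathcal C$. The following statements are equivalent. 1. There is a strong Hopf datum $\mathfrak h$ such that the corresponding strong cross product bialgebra $B_1\overset{\mathfrak h}{\bowtie}B_2$ is isomorphic to $B$ as a bialgebra. 2. There are idempotents $\Pi_1,\Pi_2\in\mathrm{End}(B)$ such that $$\mathrm m_B(\Pi_1\otimes\Pi_1)=\Pi_1\mathrm m_B(\Pi_1\otimes\Pi_1),\quad \Pi_1\eta_B=\eta_B,\quad (\Pi_2\otimes\Pi_2)\Delta_B=(\Pi_2\otimes\Pi_2)\Delta_B\Pi_2,\quad \varepsilon_B\Pi_2=\varepsilon_B,$$ the sequence $B\otimes B\xrightarrow{\mathrm m_B(\Pi_1\otimes\Pi_2)}B\xrightarrow{(\Pi_1\otimes\Pi_2)\Delta_B}B\otimes B$ is a splitting of the idempotent $\Pi_1\otimes\Pi_2$, and the strong projection relations (P1)–(P4), (P1$'$)–(P4$'$) given in the context hold. 3. There are objects $B_1$ (an algebra) and $B_2$ (a coalgebra) and morphisms $B_1\xrightarrow{\mathrm i_1}B\xrightarrow{\mathrm p_1}B_1$ and $B_2\xrightarrow{\mathrm i_2}B\xrightarrow{\mathrm p_2}B_2$, where $\mathrm i_1$ is an algebra morphism, $\mathrm p_2$ is a coalgebra morphism and $\mathrm p_j\mathrm i_j=\mathrm{id}_{B_j}$ for $j\in\{1,2\}$, such that $\mathrm m_B(\mathrm i_1\otimes\mathrm i_2):B_1\otimes B_2\to B$ and $(\mathrm p_1\otimes\mathrm p_2)\Delta_B:B\to B_1\otimes B_2$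 are mutually inverse isomorphisms, and the strong projection relations (P1)–(P4), (P1$'$)–(P4$'$) hold with $\Pi_j:=\mathrm i_j\mathrm p_j$.
   Context: $\mathcal C$ is a strict braided monoidal category with tensor product $\otimes$, unit object $\mathbb 1$ and braiding $\Psi$, in which idempotents split. Algebras, coalgebras, bialgebras, modules and comodules are taken in $\mathcal C$. Juxtaposition denotes composition; $\mathrm{id}$ (or $1$) without index is the identity of the object determined by the types. ''$X\otimes X\xrightarrow{p}Y\xrightarrow{i}X\otimes X$ is a splitting of the idempotent $\Pi$'' means $pi=\mathrm{id}_Y$ and $ip=\Pi$. Strong projection relations. For a bialgebra $B$, idempotents $\Pi_1,\Pi_2$ and $f:B\to B$ write $\mathrm m,\Delta,\eta,\varepsilon$ for the structure of $B$, $\Psi=\Psi_{B,B}$, $1=\mathrm{id}_B$, $\Phi_f=(\mathrm m\otimes1)(f\otimes\Psi)(\Delta\otimes1)$ and $\Phi'_f=(1\otimes\mathrm m)(\Psi\otimes f)(1\otimes\Delta)$. (P1) $(\Pi_2\otimes1)\Phi_{1}(\Pi_1\otimes\Pi_1)=(\Pi_2\otimes1)\Delta\Pi_1\otimes\varepsilon$; (P1$'$) $(\Pi_2\otimes\Pi_2)\Phi'_{1}(1\otimes\Pi_1)=\eta\otimes\Pi_2\mathrm m(1\otimes\Pi_1)$; (P2) $((\Pi_1\otimes\Pi_1)\Phi_{\Pi_2}\otimes1)(\Pi_2\otimes\Psi)(\Delta\Pi_1\otimes\Pi_2)=\eta\otimes\eta\otimes\Pi_1\otimes\varepsilon$; (P2$'$)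 $(\Pi_1\otimes\Pi_2\mathrm m)(\Psi\otimes\Pi_1)(1\otimes\Phi'_{\Pi_1}(\Pi_2\otimes\Pi_2))=\eta\otimes\Pi_2\otimes\varepsilon\otimes\varepsilon$; (P3) $(\Pi_1\mathrm m\otimes1)(\Pi_2\otimes\Pi_2\otimes1)(1\otimes\Delta\Pi_1)=\eta\varepsilon\otimes\Pi_1$; (P3$'$) $(\Pi_2\mathrm m\otimes1)(1\otimes\Pi_1\otimes\Pi_1)(1\otimes\Delta\Pi_2)=\Pi_2\otimes\eta\varepsilon$; (P4) $(\Pi_1\otimes\Pi_2\mathrm m(1\otimes\Pi_1)\otimes1\otimes\Pi_1)(\Psi\otimes\Phi_{\Pi_2}\otimes1)(1\otimes\Psi\otimes1\otimes1)(1\otimes\Pi_1\otimes(\Delta\Pi_1\otimes1)\Delta\Pi_2)=(\Pi_1\otimes\Pi_2\mathrm m\otimes\Pi_1\otimes\Pi_1)(\Psi\otimes1\otimes1\otimes1)(1\otimes\Delta\otimes1\otimes1)(1\otimes\Psi\otimes1)(1\otimes1\otimes(\Pi_1\otimes1)\Delta\Pi_2)$; (P4$'$) $(\Pi_1\mathrm m(1\otimes\Pi_2\mathrm m)\otimes\Pi_2\otimes1)(1\otimes1\otimes\Psi\otimes1)(1\otimes\Phi'_{\Pi_1}\otimes\Psi)(\Pi_2\otimes1\otimes(\Pi_2\otimes1)\Delta\Pi_1\otimes\Pi_2)=(\Pi_1\mathrm m(1\otimes\Pi_2)\otimes1\otimes1)(1\otimes\Psi\otimes1)(1\otimes1\otimes\mathrm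 m\otimes1)(1\otimes1\otimes1\otimes\Psi)(\Pi_2\otimes\Pi_2\otimes\Delta\Pi_1\otimes\Pi_2)$. Structure morphisms. Consider objects $B_1,B_2$ and morphisms $\mathrm m_j:B_j\otimes B_j\to B_j$, $\eta_j:\mathbb 1\to B_j$, $\Delta_j:B_j\to B_j\otimes B_j$, $\varepsilon_j:B_j\to\mathbb 1$ ($j=1,2$), $\mu_l:B_2\otimes B_1\to B_1$, $\mu_r:B_2\otimes B_1\to B_2$, $\nu_l:B_1\to B_2\otimes B_1$, $\nu_r:B_2\to B_2\otimes B_1$, $\sigma:B_2\otimes B_2\to B_1$, $\rho:B_2\to B_1\otimes B_1$. Put $\alpha=\mathrm m_2(\mu_r\otimes\mathrm{id}_{B_2})$, $\beta=(\nu_r\otimes\mathrm{id}_{B_2})\Delta_2$, $\lambda=\mathrm m_1(\mathrm{id}_{B_1}\otimes\mu_l)$, $\zeta=(\mathrm{id}_{B_1}\otimes\nu_l)\Delta_1$ and $$\varphi_{1,2}=(\mathrm m_2\otimes\mathrm m_1)(\mathrm{id}_{B_2}\otimes\Psi_{B_1,B_2}\otimes\mathrm{id}_{B_1})(\nu_l\otimes\nu_r),\quad \varphi_{2,1}=(\mu_l\otimes\mu_r)(\mathrm{id}_{B_2}\otimes\Psi_{B_2,B_1}\otimes\mathrm{id}_{B_1})(\Delta_2\otimes\Delta_1),$$ $$\hat\sigma=(\sigma\otimes\alpha)(\mathrm{id}_{B_2}\otimes\Psi_{B_2,B_2}\otimes\mathrm{id}_{B_1\otimes B_2})(\Delta_2\otimes\beta),\quad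 \hat\rho=(\lambda\otimes\mathrm m_1)(\mathrm{id}_{B_1\otimes B_2}\otimes\Psi_{B_1,B_1}\otimes\mathrm{id}_{B_1})(\zeta\otimes\rho).$$ Further put $\kappa=\mathrm m_1(\mathrm m_1\otimes\sigma)(\mathrm{id}_{B_1}\otimes\varphi_{2,1}\otimes\mathrm{id}_{B_2})$, $\omega=(\mathrm{id}_{B_1}\otimes\varphi_{1,2}\otimes\mathrm{id}_{B_2})(\rho\otimes\Delta_2)\Delta_2$, $\Theta=\Psi_{B_1\otimes B_2,\,B_1\otimes B_2}$. Hopf datum: a tuple $\mathfrak h=\big((B_1,\mathrm m_1,\eta_1,\Delta_1,\varepsilon_1),(B_2,\mathrm m_2,\eta_2,\Delta_2,\varepsilon_2);\mu_l,\mu_r,\nu_l,\nu_r,\rho,\sigma\big)$ of such objects and morphisms with: 1. $(B_1,\mathrm m_1,\eta_1)$ is an algebra and $\varepsilon_1$ an algebra morphism; 2. $(B_2,\Delta_2,\varepsilon_2)$ is a coalgebra and $\eta_2$ a coalgebra morphism; 3. $(B_1,\nu_l)$ is a left $B_2$-comodule; 4. $(B_2,\mu_r)$ is a right $B_1$-module; 5. $\Delta_1\eta_1=\eta_1\otimes\eta_1$, $(\mathrm{id}\otimes\varepsilon_1)\Delta_1=(\varepsilon_1\otimes\mathrm{id})\Delta_1=\mathrm{id}_{B_1}$, $\varepsilon_2\mathrm m_2=\varepsilon_2\otimes\varepsilon_2$, $\mathrm m_2(\mathrm{id}\otimes\eta_2)=\mathrm m_2(\eta_2\otimes\mathrm{id})=\mathrm{id}_{B_2}$,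 $\mu_r(\eta_2\otimes\mathrm{id})=\eta_2\varepsilon_1$, $\varepsilon_2\mu_r=\varepsilon_2\otimes\varepsilon_1$, $(\mathrm{id}\otimes\varepsilon_1)\nu_l=\eta_2\varepsilon_1$, $\nu_l\eta_1=\eta_2\otimes\eta_1$, $\mu_l(\eta_2\otimes\mathrm{id})=\mathrm{id}_{B_1}$, $\mu_l(\mathrm{id}\otimes\eta_1)=\eta_1\varepsilon_2$, $\varepsilon_1\mu_l=\varepsilon_2\otimes\varepsilon_1$, $(\mathrm{id}\otimes\varepsilon_1)\nu_r=\mathrm{id}_{B_2}$, $(\varepsilon_2\otimes\mathrm{id})\nu_r=\eta_1\varepsilon_2$, $\nu_r\eta_2=\eta_2\otimes\eta_1$, $\sigma(\eta_2\otimes\mathrm{id})=\sigma(\mathrm{id}\otimes\eta_2)=\eta_1\varepsilon_2$, $\varepsilon_1\sigma=\varepsilon_2\otimes\varepsilon_2$, $(\mathrm{id}\otimes\varepsilon_1)\rho=(\varepsilon_1\otimes\mathrm{id})\rho=\eta_1\varepsilon_2$, $\rho\eta_2=\eta_1\otimes\eta_1$; 6. the compatibilities: - weak (co)associativity of $\mathrm m_2$, $\Delta_1$: $\mathrm m_2(\mathrm m_2\otimes\mathrm{id})=\mathrm m_2(\mu_r\otimes\mathrm{id})(\mathrm{id}\otimes\hat\sigma)$; $(\mathrm{id}\otimes\Delta_1)\Delta_1=(\hat\rho\otimes\mathrm{id})(\mathrm{id}\otimes\nu_l)\Delta_1$; - weak (co)associativity of $\mu_l$, $\nu_r$: $\mathrm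 m_1(\mathrm{id}\otimes\mu_l)(\hat\sigma\otimes\mathrm{id})=\mathrm m_1(\mathrm{id}\otimes\sigma)(\varphi_{2,1}\otimes\mathrm{id})(\mathrm{id}\otimes\varphi_{2,1})$; $(\mathrm{id}\otimes\hat\rho)(\nu_r\otimes\mathrm{id})\Delta_2=(\varphi_{1,2}\otimes\mathrm{id})(\mathrm{id}\otimes\varphi_{1,2})(\rho\otimes\mathrm{id})\Delta_2$; - module-algebra: $\mu_l(\mathrm{id}\otimes\mathrm m_1)=\mathrm m_1(\mathrm{id}\otimes\mu_l)(\varphi_{2,1}\otimes\mathrm{id})$; $\mu_r(\mathrm m_2\otimes\mathrm{id})=\mathrm m_2(\mu_r\otimes\mathrm{id})(\mathrm{id}\otimes\varphi_{2,1})$; - comodule-coalgebra: $(\mathrm{id}\otimes\Delta_1)\nu_l=(\varphi_{1,2}\otimes\mathrm{id})(\mathrm{id}\otimes\nu_l)\Delta_1$; $(\Delta_2\otimes\mathrm{id})\nu_r=(\mathrm{id}\otimes\varphi_{1,2})(\nu_r\otimes\mathrm{id})\Delta_2$; - cocycle and cycle: $\mathrm m_1(\mathrm{id}\otimes\sigma)(\hat\sigma\otimes\mathrm{id})=\mathrm m_1(\mathrm{id}\otimes\sigma)(\varphi_{2,1}\otimes\mathrm{id})(\mathrm{id}\otimes\hat\sigma)$; $(\mathrm{id}\otimes\hat\rho)(\rho\otimes\mathrm{id})\Delta_2=(\hat\rho\otimes\mathrm{id})(\mathrm{id}\otimes\varphi_{1,2})(\rho\otimes\mathrm{id})\Delta_2$;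 - algebra-coalgebra: $\Delta_1\mathrm m_1=(\lambda\otimes\mathrm m_1)(\mathrm{id}_{B_1\otimes B_2}\otimes\Psi_{B_1,B_1}\otimes\mathrm{id}_{B_1})(\zeta\otimes\Delta_1)$; $\Delta_2\mathrm m_2=(\mathrm m_2\otimes\alpha)(\mathrm{id}_{B_2}\otimes\Psi_{B_2,B_2}\otimes\mathrm{id}_{B_1\otimes B_2})(\Delta_2\otimes\beta)$; - module-coalgebra: $\hat\rho\,\varphi_{2,1}=(\kappa\otimes\lambda)(\mathrm{id}_{B_1\otimes B_2}\otimes\Theta\otimes\mathrm{id}_{B_1})(\omega\otimes\zeta)$; $\Delta_2\mu_r=(\alpha\otimes\mu_r)(\mathrm{id}_{B_2}\otimes\Psi_{B_2,B_1\otimes B_2}\otimes\mathrm{id}_{B_1})(\Delta_2\otimes\zeta)$; - comodule-algebra: $\nu_l\mathrm m_1=(\alpha\otimes\mathrm m_1)(\mathrm{id}_{B_2}\otimes\Psi_{B_1,B_1\otimes B_2}\otimes\mathrm{id}_{B_1})(\nu_l\otimes\zeta)$; $\varphi_{1,2}\hat\sigma=(\alpha\otimes\kappa)(\mathrm{id}_{B_2}\otimes\Theta\otimes\mathrm{id}_{B_1\otimes B_2})(\beta\otimes\omega)$; - module-comodule: $\varphi_{1,2}\varphi_{2,1}=(\alpha\otimes\lambda)(\mathrm{id}_{B_2}\otimes\Theta\otimes\mathrm{id}_{B_1})(\beta\otimes\zeta)$; - cycle-cocycle: $\hat\rho\hat\sigma=(\kappa\otimes\kappa)(\mathrm{id}_{B_1\otimes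 B_2}\otimes\Theta\otimes\mathrm{id}_{B_1\otimes B_2})(\omega\otimes\omega)$. Strong Hopf datum: a Hopf datum satisfying moreover (S1) $(\mu_r\otimes1)(1\otimes\Psi_{B_1,B_1})(\nu_l\otimes1)=\nu_l\otimes\varepsilon_1$ on $B_1\otimes B_1$; (S2) $(1\otimes\mu_r)(\Psi_{B_2,B_2}\otimes1)(1\otimes\nu_l)=\eta_2\otimes\mu_r$ on $B_2\otimes B_1$; (S3) $(\sigma\otimes1\otimes1)(1\otimes\Psi_{B_1,B_2}\otimes1)(\nu_r\otimes\Psi_{B_1,B_2})(\nu_l\otimes1)=\eta_1\otimes\eta_1\otimes\mathrm{id}_{B_1}\otimes\varepsilon_2$ on $B_1\otimes B_2$; (S4) $(1\otimes\mu_r)(\Psi_{B_2,B_1}\otimes\mu_l)(1\otimes\Psi_{B_2,B_1}\otimes1)(1\otimes1\otimes\rho)=\eta_1\otimes\mathrm{id}_{B_2}\otimes\varepsilon_2\otimes\varepsilon_2$ on $B_2\otimes B_2\otimes B_2$; (S5) $(\sigma\otimes1)(1\otimes\nu_l)=\eta_1\varepsilon_2\otimes\mathrm{id}_{B_1}$ on $B_2\otimes B_1$; (S6) $(\mu_r\otimes1)(1\otimes\rho)=\mathrm{id}_{B_2}\otimes\eta_1\varepsilon_2$ on $B_2\otimes B_2$; (S7) on $B_2\otimes B_1\otimes B_2$: $(1\otimes\mu_r(1\otimes\mu_l)\otimes1\otimes1)(1\otimes1\otimes1\otimes\Psi_{B_1,B_1}\otimes1)(\Psi_{B_2,B_1}\otimes\nu_l\otimes1\otimes1)\,\xi=(1\otimes\mu_r\otimes1\otimes1)(\Psi_{B_2,B_1}\otimes\Psi_{B_1,B_1}\otimes1)\,\xi$,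 where $\xi=(1\otimes\Psi_{B_1,B_1}\otimes1\otimes1)(1\otimes1\otimes\Delta_1\otimes1)(1\otimes1\otimes\rho)$; (S8) on $B_2\otimes B_2\otimes B_1\otimes B_2$: $\chi\,(1\otimes1\otimes\mu_r\otimes\Psi_{B_1,B_2})(1\otimes\Psi_{B_2,B_2}\otimes1\otimes1\otimes1)(1\otimes1\otimes\nu_r\otimes1\otimes1)(1\otimes1\otimes\nu_l\otimes1)=\chi\,(1\otimes\Psi_{B_2,B_2}\otimes\Psi_{B_1,B_2})(1\otimes1\otimes\nu_l\otimes1)$, where $\chi=(\sigma(1\otimes\mathrm m_2)\otimes1\otimes1)(1\otimes1\otimes\Psi_{B_2,B_2}\otimes1)$. The strong cross product bialgebra $B_1\overset{\mathfrak h}{\bowtie}B_2$ corresponding to a strong Hopf datum $\mathfrak h$ is the object $B_1\otimes B_2$ with multiplication $(\mathrm m_1\otimes\mathrm{id}_{B_2})(\mathrm m_1\otimes\hat\sigma)(\mathrm{id}_{B_1}\otimes\varphi_{2,1}\otimes\mathrm{id}_{B_2})$, unit $\eta_1\otimes\eta_2$, comultiplication $(\mathrm{id}_{B_1}\otimes\varphi_{1,2}\otimes\mathrm{id}_{B_2})(\hat\rho\otimes\Delta_2)(\mathrm{id}_{B_1}\otimes\Delta_2)$ and counit $\varepsilon_1\otimes\varepsilon_2$ (this is a bialgebra in $\mathcal C$). *)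

(* Defs.v *)
From mathcomp Require Import all_boot.

Set Implicit Arguments.
Unset Strict Implicit.
Unset Printing Implicit Defensive.

Declare Scope braided_scope.
Delimit Scope braided_scope with bc.

Record category := Category {
  obj :> Type;
  mor : obj -> obj -> Type;
  idm : forall X, mor X X;
  mcomp : forall X Y Z, mor Y Z -> mor X Y -> mor X Z;
  mcompA : forall X Y Z W (f : mor Z W) (g : mor Y Z) (h : mor X Y),
    mcomp f (mcomp g h) = mcomp (mcomp f g) h;
  mcomp1m : forall X Y (f : mor X Y), mcomp (idm Y) f = f;
  mcompm1 : forall X Y (f : mor X Y), mcomp f (idm X) = f }.

Arguments mor {c}.
Arguments idm {c}.
Arguments mcomp {c X Y Z}.

Definition split_by (C : category) (X Y : C)
    (e : mor X X) (p : mor X Y) (i : mor Y X) : Prop :=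
  mcomp p i = idm Y /\ mcomp i p = e.

Definition idempotents_split (C : category) : Prop :=
  forall (X : C) (e : mor X X), mcomp e e = e ->
  exists (Y : C) (p : mor X Y) (i : mor Y X), split_by e p i.

Definition mutually_inverse (C : category) (X Y : C)
    (f : mor X Y) (g : mor Y X) : Prop :=
  mcomp g f = idm X /\ mcomp f g = idm Y.

(** The identity morphism of an object, seen as a morphism between two equal
    objects. *)
Definition idto (C : category) (X Y : C) (e : X = Y) : mor X Y :=
  match e in _ = Z return mor X Z with erefl => idm X end.

(** Strictness: the tensor product of objects is associative and unital up to
    equality, and the resulting identity morphisms are the (natural)
    associativity and unit constraints. *)
Record strict_monoidal := StrictMonoidal {
  smcat :> category;
  ten : smcat -> smcat -> smcat;
  unit_obj : smcat;
  tenm : forall X X' Y Y' : smcat,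
    mor X X' -> mor Y Y' -> mor (ten X Y) (ten X' Y');
  tenm_id : forall X Y : smcat, tenm (idm X) (idm Y) = idm (ten X Y);
  tenm_comp : forall (X X' X'' Y Y' Y'' : smcat)
      (f : mor X' X'') (f' : mor X X') (g : mor Y' Y'') (g' : mor Y Y'),
    tenm (mcomp f f') (mcomp g g') = mcomp (tenm f g) (tenm f' g');
  tenA : forall X Y Z : smcat, ten (ten X Y) Z = ten X (ten Y Z);
  ten1o : forall X : smcat, ten unit_obj X = X;
  teno1 : forall X : smcat, ten X unit_obj = X;
  tenmA : forall (X X' Y Y' Z Z' : smcat)
      (f : mor X X') (g : mor Y Y') (h : mor Z Z'),
    mcomp (idto (tenA X' Y' Z')) (tenm (tenm f g) h) =
    mcomp (tenm f (tenm g h)) (idto (tenA X Y Z));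
  ten1m : forall (X X' : smcat) (f : mor X X'),
    mcomp (idto (ten1o X')) (tenm (idm unit_obj) f) = mcomp f (idto (ten1o X));
  tenm1 : forall (X X' : smcat) (f : mor X X'),
    mcomp (idto (teno1 X')) (tenm f (idm unit_obj)) = mcomp f (idto (teno1 X)) }.

Arguments ten {s}.
Arguments unit_obj {s}.
Arguments tenm {s X X' Y Y'}.

Record strict_braided := StrictBraided {
  sbcat :> strict_monoidal;
  braid : forall X Y : sbcat, mor (ten X Y) (ten Y X);
  braid_iso : forall X Y : sbcat,
    exists g : mor (ten Y X) (ten X Y), mutually_inverse (braid X Y) g;
  braid_natural : forall (X X' Y Y' : sbcat) (f : mor X X') (g : mor Y Y'),
    mcomp (braid X' Y') (tenm f g) = mcomp (tenm g f) (braid X Y);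
  (* Psi_{X, Y (x) Z} = (id_Y (x) Psi_{X,Z}) (Psi_{X,Y} (x) id_Z) *)
  braid_hexagon_r : forall X Y Z : sbcat,
    mcomp (idto (tenA Y Z X)) (mcomp (braid X (ten Y Z)) (idto (tenA X Y Z))) =
    mcomp (tenm (idm Y) (braid X Z))
      (mcomp (idto (tenA Y X Z)) (tenm (braid X Y) (idm Z)));
  (* Psi_{X (x) Y, Z} = (Psi_{X,Z} (x) id_Y) (id_X (x) Psi_{Y,Z}) *)
  braid_hexagon_l : forall X Y Z : sbcat,
    mcomp (idto (esym (tenA Z X Y)))
      (mcomp (braid (ten X Y) Z) (idto (esym (tenA X Y Z)))) =
    mcomp (tenm (braid X Z) (idm Y))
      (mcomp (idto (esym (tenA X Z Y))) (tenm (idm X) (braid Y Z))) }.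

Arguments braid {s}.

(** Tensor words.
    A word [:: X1; ...; Xn] stands for the object X1 (x) ... (x) Xn, bracketed
    to the right; [::] is the unit object and [:: X] is X itself, so that
    [[:: B; B] --> [:: B]] is convertible to [mor (ten B B) B].  On explicit
    words, [(s ++ t) ++ u] and [s ++ (t ++ u)] are convertible, so formulas of
    the strict category can be written without casts. *)

Fixpoint word (C : strict_monoidal) (s : seq C) : C :=
  match s with
  | [::] => unit_obj
  | X :: s' => match s' with [::] => X | _ :: _ => ten X (word s') end
  end.

Lemma word_cat (C : strict_monoidal) (s t : seq C) :
  word (s ++ t) = ten (word s) (word t).
Proof.
elim: s => [|X s IHs]; first by rewrite /= ten1o.
case: s IHs => [_|Y s IHs].
  by case: t => [|Z t] //=; rewrite teno1.
change (ten X (word ((Y :: s) ++ t)) = ten (ten X (word (Y :: s))) (word t)).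
by rewrite IHs tenA.
Qed.

Definition wmor (C : strict_monoidal) (s t : seq C) : Type :=
  mor (word s) (word t).

Definition wid (C : strict_monoidal) (s : seq C) : wmor s s := idm (word s).

Definition wcomp (C : strict_monoidal) (s t u : seq C)
    (f : wmor t u) (g : wmor s t) : wmor s u := mcomp f g.

Definition wten (C : strict_monoidal) (s s' t t' : seq C)
    (f : wmor s s') (g : wmor t t') : wmor (s ++ t) (s' ++ t') :=
  mcomp (idto (esym (word_cat s' t'))) (mcomp (tenm f g) (idto (word_cat s t))).

Definition wbraid (C : strict_braided) (s t : seq C) : wmor (s ++ t) (t ++ s) :=
  mcomp (idto (esym (word_cat t s)))
    (mcomp (braid (word s) (word t)) (idto (word_cat s t))).

(** Composition is written in the applicative order and, like juxtaposition in
    the usual notation, binds tighter than the tensor product. *)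
Notation "s --> t" := (wmor s t) (at level 70) : type_scope.
Notation "f ∘ g" := (wcomp f g) (at level 35, right associativity)
  : braided_scope.
Notation "f ⊗ g" := (wten f g) (at level 40, left associativity)
  : braided_scope.
Notation Ψ := wbraid.

Open Scope braided_scope.

Section Algebras.
Context {C : strict_braided}.

Definition is_algebra (A : C)
    (m : [:: A; A] --> [:: A]) (η : [::] --> [:: A]) : Prop :=
  [/\ m ∘ (m ⊗ wid [:: A]) = m ∘ (wid [:: A] ⊗ m),
      m ∘ (η ⊗ wid [:: A]) = wid [:: A]
    & m ∘ (wid [:: A] ⊗ η) = wid [:: A]].

Definition is_coalgebra (A : C)
    (Δ : [:: A] --> [:: A; A]) (ε : [:: A] --> [::]) : Prop :=
  [/\ (Δ ⊗ wid [:: A]) ∘ Δ = (wid [:: A] ⊗ Δ) ∘ Δ,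
      (ε ⊗ wid [:: A]) ∘ Δ = wid [:: A]
    & (wid [:: A] ⊗ ε) ∘ Δ = wid [:: A]].

Definition is_algebra_morphism (s t : seq C)
    (ms : s ++ s --> s) (ηs : [::] --> s)
    (mt : t ++ t --> t) (ηt : [::] --> t) (f : s --> t) : Prop :=
  f ∘ ms = mt ∘ (f ⊗ f) /\ f ∘ ηs = ηt.

Definition is_coalgebra_morphism (s t : seq C)
    (Δs : s --> s ++ s) (εs : s --> [::])
    (Δt : t --> t ++ t) (εt : t --> [::]) (f : s --> t) : Prop :=
  Δt ∘ f = (f ⊗ f) ∘ Δs /\ εt ∘ f = εs.

Definition unit_mul : [::] ++ [::] --> ([::] : seq C) := wid [::].
Definition unit_unit : [::] --> ([::] : seq C) := wid [::].
Definition unit_comul : ([::] : seq C) --> [::] ++ [::] := wid [::].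
Definition unit_counit : ([::] : seq C) --> [::] := wid [::].

Definition is_left_comodule (H M : C)
    (Δ : [:: H] --> [:: H; H]) (ε : [:: H] --> [::])
    (ν : [:: M] --> [:: H; M]) : Prop :=
  (Δ ⊗ wid [:: M]) ∘ ν = (wid [:: H] ⊗ ν) ∘ ν /\
  (ε ⊗ wid [:: M]) ∘ ν = wid [:: M].

Definition is_right_module (H M : C)
    (m : [:: H; H] --> [:: H]) (η : [::] --> [:: H])
    (μ : [:: M; H] --> [:: M]) : Prop :=
  μ ∘ (μ ⊗ wid [:: H]) = μ ∘ (wid [:: M] ⊗ m) /\
  μ ∘ (wid [:: M] ⊗ η) = wid [:: M].

Record bialgebra_maps (s : seq C) := BialgebraMaps {
  bmul : s ++ s --> s;
  bunit : [::] --> s;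
  bcomul : s --> s ++ s;
  bcounit : s --> [::] }.

Definition is_bialgebra (B : C) (b : bialgebra_maps [:: B]) : Prop :=
  [/\ is_algebra (bmul b) (bunit b),
      is_coalgebra (bcomul b) (bcounit b),
      is_algebra_morphism (t := [:: B; B]) (bmul b) (bunit b)
        ((bmul b ⊗ bmul b) ∘ (wid [:: B] ⊗ Ψ [:: B] [:: B] ⊗ wid [:: B]))
        (bunit b ⊗ bunit b) (bcomul b)
    & is_algebra_morphism (bmul b) (bunit b) unit_mul unit_unit (bcounit b)].

Definition bialgebra_isomorphic (s t : seq C)
    (b : bialgebra_maps s) (b' : bialgebra_maps t) : Prop :=
  exists (f : s --> t) (g : t --> s),
    [/\ mutually_inverse f g,
        is_algebra_morphism (bmul b) (bunit b) (bmul b') (bunit b') f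
      & is_coalgebra_morphism (bcomul b) (bcounit b) (bcomul b') (bcounit b') f].

End Algebras.

Record bialgebra (C : strict_braided) := Bialgebra {
  bobj : C;
  bmaps :> bialgebra_maps [:: bobj];
  bialgebraP : is_bialgebra bmaps }.

Section StrongProjections.
Context {C : strict_braided} (B : bialgebra C).
Context (Π1 Π2 : [:: bobj B] --> [:: bobj B]).

Local Notation m := (bmul B).
Local Notation η := (bunit B).
Local Notation Δ := (bcomul B).
Local Notation ε := (bcounit B).
Local Notation ψ := (Ψ [:: bobj B] [:: bobj B]).
Local Notation "1" := (wid [:: bobj B]).

Definition Phi (f : [:: bobj B] --> [:: bobj B]) :
    [:: bobj B; bobj B] --> [:: bobj B; bobj B] :=
  (m ⊗ 1) ∘ (f ⊗ ψ) ∘ (Δ ⊗ 1).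

Definition Phi' (f : [:: bobj B] --> [:: bobj B]) :
    [:: bobj B; bobj B] --> [:: bobj B; bobj B] :=
  (1 ⊗ m) ∘ (ψ ⊗ f) ∘ (1 ⊗ Δ).

Record strong_projection_relations : Prop := StrongProjectionRelations {
  rel_P1 :
    (Π2 ⊗ 1) ∘ Phi 1 ∘ (Π1 ⊗ Π1) = (Π2 ⊗ 1) ∘ Δ ∘ Π1 ⊗ ε;
  rel_P1' :
    (Π2 ⊗ Π2) ∘ Phi' 1 ∘ (1 ⊗ Π1) = η ⊗ Π2 ∘ m ∘ (1 ⊗ Π1);
  rel_P2 :
    ((Π1 ⊗ Π1) ∘ Phi Π2 ⊗ 1) ∘ (Π2 ⊗ ψ) ∘ (Δ ∘ Π1 ⊗ Π2) =
    η ⊗ η ⊗ Π1 ⊗ ε;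
  rel_P2' :
    (Π1 ⊗ Π2 ∘ m) ∘ (ψ ⊗ Π1) ∘ (1 ⊗ Phi' Π1 ∘ (Π2 ⊗ Π2)) =
    η ⊗ Π2 ⊗ ε ⊗ ε;
  rel_P3 :
    (Π1 ∘ m ⊗ 1) ∘ (Π2 ⊗ Π2 ⊗ 1) ∘ (1 ⊗ Δ ∘ Π1) = η ∘ ε ⊗ Π1;
  rel_P3' :
    (Π2 ∘ m ⊗ 1) ∘ (1 ⊗ Π1 ⊗ Π1) ∘ (1 ⊗ Δ ∘ Π2) = Π2 ⊗ η ∘ ε;
  rel_P4 :
    (Π1 ⊗ Π2 ∘ m ∘ (1 ⊗ Π1) ⊗ 1 ⊗ Π1) ∘ (ψ ⊗ Phi Π2 ⊗ 1) ∘
      (1 ⊗ ψ ⊗ 1 ⊗ 1) ∘ (1 ⊗ Π1 ⊗ (Δ ∘ Π1 ⊗ 1) ∘ Δ ∘ Π2) =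
    (Π1 ⊗ Π2 ∘ m ⊗ Π1 ⊗ Π1) ∘ (ψ ⊗ 1 ⊗ 1 ⊗ 1) ∘ (1 ⊗ Δ ⊗ 1 ⊗ 1) ∘
      (1 ⊗ ψ ⊗ 1) ∘ (1 ⊗ 1 ⊗ (Π1 ⊗ 1) ∘ Δ ∘ Π2);
  rel_P4' :
    (Π1 ∘ m ∘ (1 ⊗ Π2 ∘ m) ⊗ Π2 ⊗ 1) ∘ (1 ⊗ 1 ⊗ ψ ⊗ 1) ∘
      (1 ⊗ Phi' Π1 ⊗ ψ) ∘ (Π2 ⊗ 1 ⊗ (Π2 ⊗ 1) ∘ Δ ∘ Π1 ⊗ Π2) =
    (Π1 ∘ m ∘ (1 ⊗ Π2) ⊗ 1 ⊗ 1) ∘ (1 ⊗ ψ ⊗ 1) ∘ (1 ⊗ 1 ⊗ m ⊗ 1) ∘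
      (1 ⊗ 1 ⊗ 1 ⊗ ψ) ∘ (Π2 ⊗ Π2 ⊗ Δ ∘ Π1 ⊗ Π2) }.

End StrongProjections.

Record hopf_maps (C : strict_braided) := HopfMaps {
  hB1 : C;
  hm1 : [:: hB1; hB1] --> [:: hB1];
  hη1 : [::] --> [:: hB1];
  hΔ1 : [:: hB1] --> [:: hB1; hB1];
  hε1 : [:: hB1] --> [::];
  hB2 : C;
  hm2 : [:: hB2; hB2] --> [:: hB2];
  hη2 : [::] --> [:: hB2];
  hΔ2 : [:: hB2] --> [:: hB2; hB2];
  hε2 : [:: hB2] --> [::];
  hμl : [:: hB2; hB1] --> [:: hB1];
  hμr : [:: hB2; hB1] --> [:: hB2];
  hνl : [:: hB1] --> [:: hB2; hB1];
  hνr : [:: hB2] --> [:: hB2; hB1];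
  hρ : [:: hB2] --> [:: hB1; hB1];
  hσ : [:: hB2; hB2] --> [:: hB1] }.

Section HopfDatum.
Context {C : strict_braided} (h : hopf_maps C).

Local Notation B1 := (hB1 h).
Local Notation B2 := (hB2 h).
Local Notation m1 := (hm1 h).
Local Notation m2 := (hm2 h).
Local Notation η1 := (hη1 h).
Local Notation η2 := (hη2 h).
Local Notation Δ1 := (hΔ1 h).
Local Notation Δ2 := (hΔ2 h).
Local Notation ε1 := (hε1 h).
Local Notation ε2 := (hε2 h).
Local Notation μl := (hμl h).
Local Notation μr := (hμr h).
Local Notation νl := (hνl h).
Local Notation νr := (hνr h).
Local Notation ρ := (hρ h).
Local Notation σ := (hσ h).
Local Notation id1 := (wid [:: B1]).
Local Notation id2 := (wid [:: B2]).
Local Notation id12 := (wid [:: B1; B2]).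
Local Notation Ψ11 := (Ψ [:: B1] [:: B1]).
Local Notation Ψ12 := (Ψ [:: B1] [:: B2]).
Local Notation Ψ21 := (Ψ [:: B2] [:: B1]).
Local Notation Ψ22 := (Ψ [:: B2] [:: B2]).
Local Notation Θ := (Ψ [:: B1; B2] [:: B1; B2]).

Definition hα : [:: B2; B1; B2] --> [:: B2] := m2 ∘ (μr ⊗ id2).
Definition hβ : [:: B2] --> [:: B2; B1; B2] := (νr ⊗ id2) ∘ Δ2.
Definition hλ : [:: B1; B2; B1] --> [:: B1] := m1 ∘ (id1 ⊗ μl).
Definition hζ : [:: B1] --> [:: B1; B2; B1] := (id1 ⊗ νl) ∘ Δ1.

Definition hφ12 : [:: B1; B2] --> [:: B2; B1] :=
  (m2 ⊗ m1) ∘ (id2 ⊗ Ψ12 ⊗ id1) ∘ (νl ⊗ νr).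
Definition hφ21 : [:: B2; B1] --> [:: B1; B2] :=
  (μl ⊗ μr) ∘ (id2 ⊗ Ψ21 ⊗ id1) ∘ (Δ2 ⊗ Δ1).

Definition hσhat : [:: B2; B2] --> [:: B1; B2] :=
  (σ ⊗ hα) ∘ (id2 ⊗ Ψ22 ⊗ id12) ∘ (Δ2 ⊗ hβ).
Definition hρhat : [:: B1; B2] --> [:: B1; B1] :=
  (hλ ⊗ m1) ∘ (id12 ⊗ Ψ11 ⊗ id1) ∘ (hζ ⊗ ρ).

Definition hκ : [:: B1; B2; B1; B2] --> [:: B1] :=
  m1 ∘ (m1 ⊗ σ) ∘ (id1 ⊗ hφ21 ⊗ id2).
Definition hω : [:: B2] --> [:: B1; B2; B1; B2] :=
  (id1 ⊗ hφ12 ⊗ id2) ∘ (ρ ⊗ Δ2) ∘ Δ2.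

Local Notation α := hα.
Local Notation β := hβ.
Local Notation λ := hλ.
Local Notation ζ := hζ.
Local Notation φ12 := hφ12.
Local Notation φ21 := hφ21.
Local Notation σ' := hσhat.
Local Notation ρ' := hρhat.
Local Notation κ := hκ.
Local Notation ω := hω.

Record is_hopf_datum : Prop := IsHopfDatum {
  hd_algebra1 : is_algebra m1 η1;
  hd_counit1 :
    is_algebra_morphism (s := [:: B1]) m1 η1 unit_mul unit_unit ε1;
  hd_coalgebra2 : is_coalgebra Δ2 ε2;
  hd_unit2 :
    is_coalgebra_morphism (t := [:: B2]) unit_comul unit_counit Δ2 ε2 η2;
  hd_comodule : is_left_comodule Δ2 ε2 νl;
  hd_module : is_right_module m1 η1 μr;

  hd_Δ1_η1 : Δ1 ∘ η1 = η1 ⊗ η1;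
  hd_Δ1_ε1r : (id1 ⊗ ε1) ∘ Δ1 = id1;
  hd_Δ1_ε1l : (ε1 ⊗ id1) ∘ Δ1 = id1;
  hd_ε2_m2 : ε2 ∘ m2 = ε2 ⊗ ε2;
  hd_m2_η2r : m2 ∘ (id2 ⊗ η2) = id2;
  hd_m2_η2l : m2 ∘ (η2 ⊗ id2) = id2;
  hd_μr_η2 : μr ∘ (η2 ⊗ id1) = η2 ∘ ε1;
  hd_ε2_μr : ε2 ∘ μr = ε2 ⊗ ε1;
  hd_ε1_νl : (id2 ⊗ ε1) ∘ νl = η2 ∘ ε1;
  hd_νl_η1 : νl ∘ η1 = η2 ⊗ η1;
  hd_μl_η2 : μl ∘ (η2 ⊗ id1) = id1;
  hd_μl_η1 : μl ∘ (id2 ⊗ η1) = η1 ∘ ε2;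
  hd_ε1_μl : ε1 ∘ μl = ε2 ⊗ ε1;
  hd_ε1_νr : (id2 ⊗ ε1) ∘ νr = id2;
  hd_ε2_νr : (ε2 ⊗ id1) ∘ νr = η1 ∘ ε2;
  hd_νr_η2 : νr ∘ η2 = η2 ⊗ η1;
  hd_σ_η2l : σ ∘ (η2 ⊗ id2) = η1 ∘ ε2;
  hd_σ_η2r : σ ∘ (id2 ⊗ η2) = η1 ∘ ε2;
  hd_ε1_σ : ε1 ∘ σ = ε2 ⊗ ε2;
  hd_ε1_ρr : (id1 ⊗ ε1) ∘ ρ = η1 ∘ ε2;
  hd_ε1_ρl : (ε1 ⊗ id1) ∘ ρ = η1 ∘ ε2;
  hd_ρ_η2 : ρ ∘ η2 = η1 ⊗ η1;

  hd_weak_assoc_m2 : m2 ∘ (m2 ⊗ id2) = m2 ∘ (μr ⊗ id2) ∘ (id2 ⊗ σ');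
  hd_weak_coassoc_Δ1 :
    (id1 ⊗ Δ1) ∘ Δ1 = (ρ' ⊗ id1) ∘ (id1 ⊗ νl) ∘ Δ1;

  hd_weak_assoc_μl :
    m1 ∘ (id1 ⊗ μl) ∘ (σ' ⊗ id1) =
    m1 ∘ (id1 ⊗ σ) ∘ (φ21 ⊗ id2) ∘ (id2 ⊗ φ21);
  hd_weak_coassoc_νr :
    (id2 ⊗ ρ') ∘ (νr ⊗ id2) ∘ Δ2 =
    (φ12 ⊗ id1) ∘ (id1 ⊗ φ12) ∘ (ρ ⊗ id2) ∘ Δ2;

  hd_module_algebra_μl :
    μl ∘ (id2 ⊗ m1) = m1 ∘ (id1 ⊗ μl) ∘ (φ21 ⊗ id1);
  hd_module_algebra_μr :
    μr ∘ (m2 ⊗ id1) = m2 ∘ (μr ⊗ id2) ∘ (id2 ⊗ φ21);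

  hd_comodule_coalgebra_νl :
    (id2 ⊗ Δ1) ∘ νl = (φ12 ⊗ id1) ∘ (id1 ⊗ νl) ∘ Δ1;
  hd_comodule_coalgebra_νr :
    (Δ2 ⊗ id1) ∘ νr = (id2 ⊗ φ12) ∘ (νr ⊗ id2) ∘ Δ2;

  hd_cocycle :
    m1 ∘ (id1 ⊗ σ) ∘ (σ' ⊗ id2) =
    m1 ∘ (id1 ⊗ σ) ∘ (φ21 ⊗ id2) ∘ (id2 ⊗ σ');
  hd_cycle :
    (id1 ⊗ ρ') ∘ (ρ ⊗ id2) ∘ Δ2 =
    (ρ' ⊗ id1) ∘ (id1 ⊗ φ12) ∘ (ρ ⊗ id2) ∘ Δ2;

  hd_algebra_coalgebra1 :
    Δ1 ∘ m1 = (λ ⊗ m1) ∘ (id12 ⊗ Ψ11 ⊗ id1) ∘ (ζ ⊗ Δ1);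
  hd_algebra_coalgebra2 :
    Δ2 ∘ m2 = (m2 ⊗ α) ∘ (id2 ⊗ Ψ22 ⊗ id12) ∘ (Δ2 ⊗ β);

  hd_module_coalgebra1 :
    ρ' ∘ φ21 = (κ ⊗ λ) ∘ (id12 ⊗ Θ ⊗ id1) ∘ (ω ⊗ ζ);
  hd_module_coalgebra2 :
    Δ2 ∘ μr =
    (α ⊗ μr) ∘ (id2 ⊗ Ψ [:: B2] [:: B1; B2] ⊗ id1) ∘ (Δ2 ⊗ ζ);

  hd_comodule_algebra1 :
    νl ∘ m1 =
    (α ⊗ m1) ∘ (id2 ⊗ Ψ [:: B1] [:: B1; B2] ⊗ id1) ∘ (νl ⊗ ζ);
  hd_comodule_algebra2 :
    φ12 ∘ σ' = (α ⊗ κ) ∘ (id2 ⊗ Θ ⊗ id12) ∘ (β ⊗ ω);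

  hd_module_comodule :
    φ12 ∘ φ21 = (α ⊗ λ) ∘ (id2 ⊗ Θ ⊗ id1) ∘ (β ⊗ ζ);

  hd_cycle_cocycle :
    ρ' ∘ σ' = (κ ⊗ κ) ∘ (id12 ⊗ Θ ⊗ id12) ∘ (ω ⊗ ω) }.

Definition hξ : [:: B2; B1; B2] --> [:: B2; B1; B1; B1; B1] :=
  (id2 ⊗ Ψ11 ⊗ id1 ⊗ id1) ∘ (id2 ⊗ id1 ⊗ Δ1 ⊗ id1) ∘ (id2 ⊗ id1 ⊗ ρ).

Definition hχ : [:: B2; B2; B2; B2; B1] --> [:: B1; B2; B1] :=
  (σ ∘ (id2 ⊗ m2) ⊗ id2 ⊗ id1) ∘ (id2 ⊗ id2 ⊗ Ψ22 ⊗ id1).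

Local Notation ξ := hξ.
Local Notation χ := hχ.

Record is_strong_hopf_datum : Prop := IsStrongHopfDatum {
  strong_hopf_datum :> is_hopf_datum;
  hd_S1 : (μr ⊗ id1) ∘ (id2 ⊗ Ψ11) ∘ (νl ⊗ id1) = νl ⊗ ε1;
  hd_S2 : (id2 ⊗ μr) ∘ (Ψ22 ⊗ id1) ∘ (id2 ⊗ νl) = η2 ⊗ μr;
  hd_S3 :
    (σ ⊗ id1 ⊗ id1) ∘ (id2 ⊗ Ψ12 ⊗ id1) ∘ (νr ⊗ Ψ12) ∘ (νl ⊗ id2) =
    η1 ⊗ η1 ⊗ id1 ⊗ ε2;
  hd_S4 :
    (id1 ⊗ μr) ∘ (Ψ21 ⊗ μl) ∘ (id2 ⊗ Ψ21 ⊗ id1) ∘ (id2 ⊗ id2 ⊗ ρ) =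
    η1 ⊗ id2 ⊗ ε2 ⊗ ε2;
  hd_S5 : (σ ⊗ id1) ∘ (id2 ⊗ νl) = η1 ∘ ε2 ⊗ id1;
  hd_S6 : (μr ⊗ id1) ∘ (id2 ⊗ ρ) = id2 ⊗ η1 ∘ ε2;
  hd_S7 :
    (id1 ⊗ μr ∘ (id2 ⊗ μl) ⊗ id1 ⊗ id1) ∘
      (id1 ⊗ id2 ⊗ id2 ⊗ Ψ11 ⊗ id1) ∘ (Ψ21 ⊗ νl ⊗ id1 ⊗ id1) ∘ ξ =
    (id1 ⊗ μr ⊗ id1 ⊗ id1) ∘ (Ψ21 ⊗ Ψ11 ⊗ id1) ∘ ξ;
  hd_S8 :
    χ ∘ (id2 ⊗ id2 ⊗ μr ⊗ Ψ12) ∘ (id2 ⊗ Ψ22 ⊗ id1 ⊗ id1 ⊗ id2) ∘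
      (id2 ⊗ id2 ⊗ νr ⊗ id1 ⊗ id2) ∘ (id2 ⊗ id2 ⊗ νl ⊗ id2) =
    χ ∘ (id2 ⊗ Ψ22 ⊗ Ψ12) ∘ (id2 ⊗ id2 ⊗ νl ⊗ id2) }.

Definition cross_product : bialgebra_maps [:: B1; B2] :=
  BialgebraMaps (s := [:: B1; B2])
    ((m1 ⊗ id2) ∘ (m1 ⊗ σ') ∘ (id1 ⊗ φ21 ⊗ id2))
    (η1 ⊗ η2)
    ((id1 ⊗ φ12 ⊗ id2) ∘ (ρ' ⊗ Δ2) ∘ (id1 ⊗ Δ2))
    (ε1 ⊗ ε2).

End HopfDatum.

(* Main.v *)
From Stdlib Require Import Eqdep.
Require Import Defs.
From mathcomp Require Import all_boot zify.

Set Implicit Arguments.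
Unset Strict Implicit.
Unset Printing Implicit Defensive.

(** Everything is read off from one bijection.  Let [i1], [p1], [i2], [p2] be
    as in the third statement, and write [f] for the isomorphism
    [m ∘ (i1 ⊗ i2) : B1 ⊗ B2 -> B] and [g] for its inverse
    [(p1 ⊗ p2) ∘ Δ].  The eight maps of a Hopf datum are forced: each one is a
    component of the multiplication or of the comultiplication of [B], such as
    [μl = p1 ∘ m ∘ (i2 ⊗ i1)] or [ρ = (p1 ⊗ p1) ∘ Δ ∘ i2].  The record
    [realized] says that the maps of [h] are these components.

    Already without any strong relation, [i1] being an algebra morphism and
    [p2] a coalgebra morphism, with [f] and [g] inverse to each other, [p1] is
    left [B1]-linear, [p2] kills the left action of [B1] up to [ε1], and dually
    [i1] consists of right [B2]-coinvariants and [i2] is right [B2]-colinear.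
    Hence [Π2] may be inserted or erased on the left argument of [p2 ∘ m], and
    [Π1] on the right leg of [Δ ∘ i1] ([p2_mul_Π2], [comul_i1_Π1]).  Composing
    with the [i]'s and [p]'s then turns each of the projection relations into
    one of the strong Hopf datum conditions and back ([rel_P1_S1], ...,
    [rel_P4'_S8]).  This settles the strong part in both directions.

    From the first statement to the third: inside a cross product the maps
    [id ⊗ η2], [id ⊗ ε2], [η1 ⊗ id], [ε1 ⊗ id] realize [h]; this is a
    computation with the unit and counit conditions, carried along the given
    isomorphism ([cross_product_realized]).

    From the third statement to the first, the heart is that the composites of
    a Hopf datum are components of [B] as well:
    [φ21 = g ∘ m ∘ (i2 ⊗ i1)], [φ12 = (p2 ⊗ p1) ∘ Δ ∘ f],
    [σhat = g ∘ m ∘ (i2 ⊗ i2)] and [ρhat = (p1 ⊗ p1) ∘ Δ ∘ f]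
    ([hφ21_realized], ..., [hρhat_realized]).  Expanding [Δ ∘ m], the claim for
    [φ21] is that [p1 (b' a') ⊗ p2 (b'' a'')] does not change when [a'] is
    replaced by its [Π1]-part.  Writing [a'] as the product of its two parts,
    the [Π2]-part is the coaction [νl], evaluated next to a right action
    [μr] by the rest of [a], and [hd_S2] makes exactly this coaction trivial.
    For [σhat] the superfluous part is a cycle [ρ] whose second leg acts by
    [μr]; [hd_S2] and [hd_S4] remove it.  The other two are dual, with [hd_S1]
    and [hd_S3].  Once these four formulas are known, [f] and [g] cancel in
    every axiom of a Hopf datum, which becomes associativity,
    coassociativity or the bialgebra axiom of [B], or a component of one of
    them; only the two algebra-coalgebra conditions need one more argument,
    from [hd_S5] and [hd_S6].

    The equations are string diagram equations.  The first part of the file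
    is a reflective procedure for them: a diagram is coded as a list of
    boxes with their positions, rewriting with given equations modulo the
    interchange law is computed on codes, and one soundness theorem
    ([strings_sound]) turns the outcome into an equality of morphisms.  The
    mathematical content of a proof that calls [strings] lies in the
    intermediate diagrams and in the list of equations used. *)

(** * Morphisms up to equality of their objects *)

(** Tensor products are associative up to equality of objects only.  Packing a
    morphism with its domain and codomain makes the tensor product of
    morphisms strictly associative and unital, without casts; uniqueness of
    identity proofs leads back to morphisms ([Arr_inj]). *)
Record arr (C : category) := Arr { adom : C; acod : C; amor : mor adom acod }.
Arguments Arr {C adom acod}.

Lemma Arr_inj (C : category) (X Y : C) (f g : mor X Y) : Arr f = Arr g -> f = g.
Proof.
move=> e; injection e => e'.
exact: (EqdepTheory.inj_pair2 _ _ _ _ _ (EqdepTheory.inj_pair2 _ _ _ _ _ e')).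
Qed.

Lemma Arr_comp (C : category) (X Y Z X' Y' Z' : C) (f : mor X Y) (g : mor Y Z)
    (f' : mor X' Y') (g' : mor Y' Z') :
  Arr f = Arr f' -> Arr g = Arr g' -> Arr (mcomp g f) = Arr (mcomp g' f').
Proof.
move=> ef eg.
have eX := congr1 (@adom _) ef; have eY := congr1 (@acod _) ef.
have eZ := congr1 (@acod _) eg; simpl in eX, eY, eZ.
by subst X' Y' Z'; rewrite (Arr_inj ef) (Arr_inj eg).
Qed.

Lemma Arr_idto (C : category) (X Y : C) (e : X = Y) : Arr (idto e) = Arr (idm X).
Proof. by case: Y / e. Qed.

Lemma Arr_idl (C : category) (X Y Z : C) (e : Y = Z) (f : mor X Y) :
  Arr (mcomp (idto e) f) = Arr f.
Proof. by case: Z / e; rewrite /= mcomp1m. Qed.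

Lemma Arr_idr (C : category) (X Y Z : C) (e : X = Y) (f : mor Y Z) :
  Arr (mcomp f (idto e)) = Arr f.
Proof. by case: Y / e f => f; rewrite /= mcompm1. Qed.

Lemma Arr_idm (C : category) (X Y : C) : X = Y -> Arr (idm X) = Arr (idm Y).
Proof. by move->. Qed.

Section ArrTensor.
Variable M : strict_monoidal.

Definition arr_ten (a b : arr M) : arr M := Arr (tenm (amor a) (amor b)).

Lemma arr_tenA (a b c : arr M) :
  arr_ten (arr_ten a b) c = arr_ten a (arr_ten b c).
Proof.
by rewrite /arr_ten /= -(Arr_idl (tenA _ _ _)) tenmA Arr_idr.
Qed.

Lemma arr_ten1l (a : arr M) : arr_ten (Arr (idm unit_obj)) a = a.
Proof.
by case: a => X Y f; rewrite /arr_ten /= -(Arr_idl (ten1o _)) ten1m Arr_idr.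
Qed.

Lemma arr_ten1r (a : arr M) : arr_ten a (Arr (idm unit_obj)) = a.
Proof.
by case: a => X Y f; rewrite /arr_ten /= -(Arr_idl (teno1 _)) tenm1 Arr_idr.
Qed.

Lemma arr_ten_id (X Y : M) :
  arr_ten (Arr (idm X)) (Arr (idm Y)) = Arr (idm (ten X Y)).
Proof. by rewrite /arr_ten /= tenm_id. Qed.

Lemma Arr_wten (s s' t t' : seq M) (f : s --> s') (g : t --> t') :
  Arr (f ⊗ g) = arr_ten (Arr f) (Arr g).
Proof. by rewrite /wten Arr_idl Arr_idr. Qed.

End ArrTensor.

(** * Codes of string diagrams *)

(** A diagram is a list of slices, in the order of application; the slice
    [(k, i)] is the box number [i] with [k] wires to its left.  The wires to
    its right are left implicit. *)
Definition diag := seq (nat * nat).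

Definition shift k (d : diag) : diag := [seq (k + x.1, x.2) | x <- d].

Definition slice (d : diag) i := nth (0, 0) d i.

Record rule := Rule { rdom : seq nat; rlhs : diag; rrhs : diag }.
Definition rule0 := Rule [::] [::] [::].

(** [Exchange b n] swaps the slices [n] and [n.+1]; [b] says whether the later
    box counts as lying to the right of the earlier one, a matter of choice for
    a box without outputs followed by a box without inputs at the same place.
    [Replace i n k] replaces the left hand side of rule [i], found from slice
    [n] on with [k] wires to its left. *)
Inductive op := Exchange of bool & nat | Replace of nat & nat & nat.

Section Operations.
Variable types : seq (seq nat * seq nat).

Definition dom_of i := (nth ([::], [::]) types i).1.
Definition cod_of i := (nth ([::], [::]) types i).2.

Definition exchange (b : bool) (x y : nat * nat) : option diag :=
  let: (k1, i1) := x in let: (k2, i2) := y in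
  let c1 := size (cod_of i1) in let d1 := size (dom_of i1) in
  let c2 := size (cod_of i2) in let d2 := size (dom_of i2) in
  if b then
    if k1 + c1 <= k2 then Some [:: (k2 - c1 + d1, i2); (k1, i1)] else None
  else if k2 + d2 <= k1 then Some [:: (k2, i2); (k1 - d2 + c2, i1)] else None.

Fixpoint word_after (d : diag) (s : seq nat) : seq nat :=
  match d with
  | [::] => s
  | (k, i) :: d' =>
      word_after d' (take k s ++ cod_of i ++ drop (k + size (dom_of i)) s)
  end.

Variable rules : seq rule.

Definition step (s : seq nat) (o : op) (d : diag) : diag :=
  match o with
  | Exchange b n =>
      if drop n d is x :: y :: d' then
        if exchange b x y is Some l then take n d ++ l ++ d' else d
      else d
  | Replace i n k =>
      let r := nth rule0 rules i in
      let s' := word_after (take n d) s in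
      (* The wires under the left hand side are compared with the domain of
         the rule, since some of them may run past all boxes of the rule. *)
      if (take (size (rdom r)) (drop k s') == rdom r) && (k <= size s')
           && (take (size (rlhs r)) (drop n d) == shift k (rlhs r))
      then take n d ++ shift k (rrhs r) ++ drop (n + size (rlhs r)) d
      else d
  end.

Definition steps s (os : seq op) d := foldl (fun d o => step s o d) d os.

End Operations.

(** * Soundness of the operations on codes *)

Section Semantics.
Variables (M : strict_monoidal) (v : nat -> M).

Definition wobj (s : seq nat) : M := word (map v s).

Lemma wobj_cat s t : wobj (s ++ t) = ten (wobj s) (wobj t).
Proof. by rewrite /wobj map_cat word_cat. Qed.

Lemma wobj_cat3 u s w : wobj (u ++ s ++ w) = ten (wobj u) (ten (wobj s) (wobj w)).
Proof. by rewrite !wobj_cat. Qed.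

Definition arr_id s : arr M := Arr (idm (wobj s)).

Lemma arr_id_cat s t : arr_id (s ++ t) = arr_ten (arr_id s) (arr_id t).
Proof. by rewrite arr_ten_id; apply: Arr_idm; exact: wobj_cat. Qed.

Lemma whisk_subproof u w (s t : seq nat) (f : mor (wobj s) (wobj t)) :
  {h : mor (wobj (u ++ s ++ w)) (wobj (u ++ t ++ w))
     | Arr h = arr_ten (arr_id u) (arr_ten (Arr f) (arr_id w))}.
Proof.
exists (mcomp (idto (esym (wobj_cat3 u t w)))
  (mcomp (tenm (idm (wobj u)) (tenm f (idm (wobj w)))) (idto (wobj_cat3 u s w)))).
by rewrite Arr_idl Arr_idr.
Qed.

Definition whisk u w s t f := sval (@whisk_subproof u w s t f).

Lemma Arr_whisk u w s t (f : mor (wobj s) (wobj t)) :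
  Arr (whisk u w f) = arr_ten (arr_id u) (arr_ten (Arr f) (arr_id w)).
Proof. exact: svalP (whisk_subproof u w f). Qed.

Lemma whisk_comp u w s t r (f : mor (wobj s) (wobj t)) (g : mor (wobj t) (wobj r)) :
  whisk u w (mcomp g f) = mcomp (whisk u w g) (whisk u w f).
Proof.
apply: Arr_inj; rewrite Arr_whisk.
transitivity (Arr (mcomp (tenm (idm (wobj u)) (tenm g (idm (wobj w))))
                         (tenm (idm (wobj u)) (tenm f (idm (wobj w)))))).
  by rewrite /arr_ten /= -!tenm_comp !mcomp1m.
by apply: Arr_comp; rewrite Arr_whisk.
Qed.

(** The interchange law, for two boxes separated by the wires [x]. *)
Lemma whisk_interchange (u x w a b a' b' : seq nat)
    (f : mor (wobj a) (wobj a')) (g : mor (wobj b) (wobj b'))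
    (e1 : u ++ a' ++ x ++ b ++ w = (u ++ a' ++ x) ++ b ++ w)
    (e2 : (u ++ a ++ x) ++ b' ++ w = u ++ a ++ x ++ b' ++ w) :
  Arr (mcomp (whisk (u ++ a' ++ x) w g)
        (mcomp (idto (congr1 wobj e1)) (whisk u (x ++ b ++ w) f))) =
  Arr (mcomp (whisk u (x ++ b' ++ w) f)
        (mcomp (idto (congr1 wobj e2)) (whisk (u ++ a ++ x) w g))).
Proof.
transitivity (Arr (tenm (idm (wobj u)) (tenm f (tenm (idm (wobj x))
  (tenm g (idm (wobj w))))))).
- set F := tenm (idm (wobj u)) (tenm f (tenm (idm (wobj x))
    (tenm (idm (wobj b)) (idm (wobj w))))).
  set G := tenm (idm (wobj u)) (tenm (idm (wobj a')) (tenm (idm (wobj x))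
    (tenm g (idm (wobj w))))).
  transitivity (Arr (mcomp G F)).
    apply: Arr_comp; first by rewrite Arr_idl Arr_whisk !arr_id_cat.
    by rewrite Arr_whisk !arr_id_cat !arr_tenA.
  by rewrite /F /G -!tenm_comp !mcomp1m mcompm1.
- set F := tenm (idm (wobj u)) (tenm f (tenm (idm (wobj x))
    (tenm (idm (wobj b')) (idm (wobj w))))).
  set G := tenm (idm (wobj u)) (tenm (idm (wobj a)) (tenm (idm (wobj x))
    (tenm g (idm (wobj w))))).
  transitivity (Arr (mcomp F G)).
    by rewrite /F /G -!tenm_comp !mcomp1m mcompm1.
  apply: Arr_comp; first by rewrite Arr_idl Arr_whisk !arr_id_cat !arr_tenA.
  by rewrite Arr_whisk !arr_id_cat.
Qed.

Record box := Box {
  bdom : seq nat; bcod : seq nat; bmor : mor (wobj bdom) (wobj bcod) }.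
Definition box0 := @Box [::] [::] (idm _).
Variable boxes : seq box.
Local Notation bx := (nth box0 boxes).

(** A relation and not a partial function: well-formedness of the code is
    part of it, and the words of wires beside a box need not be computed. *)
Fixpoint denotes (d : diag) (s t : seq nat) : mor (wobj s) (wobj t) -> Prop :=
  match d with
  | [::] => fun f => s = t /\ Arr f = arr_id s
  | (k, i) :: d' => fun f =>
      exists u w (h : mor (wobj (u ++ bcod (bx i) ++ w)) (wobj t)),
        [/\ size u = k, s = u ++ bdom (bx i) ++ w, denotes d' h
          & Arr f = Arr (mcomp h (whisk u w (bmor (bx i))))]
  end.

Lemma cat_inj (T : Type) (u u' w w' : seq T) :
  size u = size u' -> u ++ w = u' ++ w' -> u = u' /\ w = w'.
Proof.
elim: u u' => [|x u IH] [|x' u'] //= [e] [-> e'].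
by have [-> ->] := IH _ e e'.
Qed.

Lemma cat_split (T : Type) (u1 w1 u2 w2 : seq T) :
  size u1 <= size u2 -> u1 ++ w1 = u2 ++ w2 ->
  exists x, u2 = u1 ++ x /\ w1 = x ++ w2.
Proof.
elim: u1 u2 => [|x u1 IH] [|y u2] //=; [by exists [::]|by exists (y :: u2)|].
by move=> le [<- e]; have [z [-> ->]] := IH _ le e; exists z.
Qed.

Lemma denotes_det d s t f t' f' :
  @denotes d s t f -> @denotes d s t' f' -> t = t' /\ Arr f = Arr f'.
Proof.
elim: d s t f t' f' => [|[k i] d IH] s t f t' f' /=.
  by case=> e1 -> [e2 ->]; subst.
case=> u [w [h [eu es sh ->]]] [u' [w' [h' [eu' es' sh' ->]]]].
rewrite es in es'; have [] := cat_inj (etrans eu (esym eu')) es'.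
move=> e; subst u' => /cat_inj [] // _ e; subst w'.
have [e eh] := IH _ _ _ _ _ sh sh'; subst t'.
by split=> //; apply: Arr_comp.
Qed.

Lemma denotes_Arr d s t s' t' (f : mor (wobj s) (wobj t))
    (f' : mor (wobj s') (wobj t')) :
  s = s' -> t = t' -> Arr f = Arr f' -> denotes d f -> denotes d f'.
Proof. by move=> es et; subst s' t' => /Arr_inj ->. Qed.

Lemma denotes_cat d1 d2 s t r f g :
  @denotes d1 s t f -> @denotes d2 t r g -> denotes (d1 ++ d2) (mcomp g f).
Proof.
elim: d1 s f => [|[k i] d IH] s f /=.
  case=> es ef; apply: denotes_Arr => //; subst t.
  by rewrite (Arr_inj ef) mcompm1.
case=> u [w [h [eu es sh ef]]] sg.
exists u, w, (mcomp g h); split=> //; first exact: IH.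
by rewrite -mcompA; apply: Arr_comp.
Qed.

Lemma denotes_cat_inv d1 d2 s r h : @denotes (d1 ++ d2) s r h ->
  exists t f g, [/\ @denotes d1 s t f, @denotes d2 t r g & h = mcomp g f].
Proof.
elim: d1 s h => [|[k i] d IH] s h /=.
  by move=> sh; exists s, (idm _), h; rewrite mcompm1.
case=> u [w [h0 [eu es sh0 eh]]].
have [t [f [g [sf sg e]]]] := IH _ _ sh0; subst s.
exists t, (mcomp f (whisk u w (bmor (bx i)))), g; split=> //.
  by exists u, w, f.
by apply: Arr_inj; rewrite eh e mcompA.
Qed.

Lemma denotes_whisk d u w s t f :
  @denotes d s t f -> denotes (shift (size u) d) (whisk u w f).
Proof.
elim: d s f => [|[k i] d IH] s f /=.
  case=> es ef; subst t; split=> //.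
  by rewrite Arr_whisk ef -!arr_id_cat.
case=> u0 [w0 [h [eu es sh ef]]]; subst s.
set g := bx i in h sh ef *.
have ed : u ++ (u0 ++ bcod g ++ w0) ++ w = (u ++ u0) ++ bcod g ++ (w0 ++ w).
  by rewrite !catA.
pose h' : mor (wobj ((u ++ u0) ++ bcod g ++ (w0 ++ w))) (wobj (u ++ t ++ w)) :=
  mcomp (whisk u w h) (idto (congr1 wobj (esym ed))).
have eh' : Arr h' = Arr (whisk u w h) by rewrite /h' Arr_idr.
exists (u ++ u0), (w0 ++ w), h'; split.
- by rewrite size_cat eu.
- by rewrite !catA.
- by apply: (denotes_Arr _ _ (esym eh') (IH _ _ sh)).
rewrite (Arr_inj ef) whisk_comp; apply: Arr_comp => //.
by rewrite !Arr_whisk !arr_id_cat !arr_tenA.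
Qed.

Variable types : seq (seq nat * seq nat).
Hypothesis typesE : types = [seq (bdom g, bcod g) | g <- boxes].

Lemma typesP i : dom_of types i = bdom (bx i) /\ cod_of types i = bcod (bx i).
Proof.
rewrite /dom_of /cod_of typesE.
suff -> : nth ([::], [::]) [seq (bdom g, bcod g) | g <- boxes] i
    = (bdom (bx i), bcod (bx i)) by [].
by elim: boxes i => [|g l IH] [|i] //=.
Qed.

Lemma denotes_exchange b x y l d s t f : exchange types b x y = Some l ->
  @denotes (x :: y :: d) s t f -> denotes (l ++ d) f.
Proof.
case: x y => k1 i1 [k2 i2] /=.
have [-> ->] := typesP i1; have [-> ->] := typesP i2.
set g1 := bx i1; set g2 := bx i2.
move=> el [u1 [w1 [h1 [eu1 es [u2 [w2 [h2 [eu2 es2 sh2 eh1]]]] ef]]]].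
subst s k1 k2; case: b el.
  case: ifP => // le [<-] /=.
  have := es2; rewrite catA => /cat_split.
  rewrite size_cat => /(_ le) [x [ex ew]]; subst u2 w1.
  have e1 : u1 ++ bcod g1 ++ x ++ bdom g2 ++ w2 =
            (u1 ++ bcod g1 ++ x) ++ bdom g2 ++ w2 by rewrite !catA.
  have e2 : (u1 ++ bdom g1 ++ x) ++ bcod g2 ++ w2 =
            u1 ++ bdom g1 ++ x ++ bcod g2 ++ w2 by rewrite !catA.
  have e3 : u1 ++ bcod g1 ++ x ++ bcod g2 ++ w2 =
            ((u1 ++ bcod g1) ++ x) ++ bcod g2 ++ w2 by rewrite !catA.
  have e4 : (u1 ++ bcod g1 ++ x) ++ bcod g2 ++ w2 =
            ((u1 ++ bcod g1) ++ x) ++ bcod g2 ++ w2 by rewrite !catA.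
  have [h3 eh3] : exists h : mor (wobj (u1 ++ bcod g1 ++ x ++ bcod g2 ++ w2))
                                 (wobj t), Arr h = Arr h2.
    by exists (mcomp h2 (idto (congr1 wobj e3))); rewrite Arr_idr.
  have [h4 eh4] : exists h : mor (wobj ((u1 ++ bcod g1 ++ x) ++ bcod g2 ++ w2))
                                 (wobj t), Arr h = Arr h2.
    by exists (mcomp h2 (idto (congr1 wobj e4))); rewrite Arr_idr.
  have S : denotes ((size u1, i1) :: d)
      (mcomp h3 (whisk u1 (x ++ bcod g2 ++ w2) (bmor g1))).
    exists u1, (x ++ bcod g2 ++ w2), h3; split=> //.
    exact: denotes_Arr sh2.
  exists (u1 ++ bdom g1 ++ x), w2, (mcomp
    (mcomp h3 (whisk u1 (x ++ bcod g2 ++ w2) (bmor g1))) (idto (congr1 wobj e2))).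
  split; [by rewrite !size_cat; lia | by rewrite !catA | |].
    by refine (denotes_Arr (esym e2) erefl _ S); rewrite Arr_idr.
  rewrite ef.
  transitivity (Arr (mcomp h4 (mcomp (whisk (u1 ++ bcod g1 ++ x) w2 (bmor g2))
     (mcomp (idto (congr1 wobj e1)) (whisk u1 (x ++ bdom g2 ++ w2) (bmor g1)))))).
    rewrite (mcompA h4) (mcompA (mcomp _ _)).
    apply: Arr_comp => //.
    rewrite Arr_idr eh1; apply: Arr_comp; last by rewrite eh4.
    by rewrite !Arr_whisk !arr_id_cat !arr_tenA.
  rewrite -!mcompA.
  apply: Arr_comp; last by rewrite eh3 eh4.
  exact: whisk_interchange.
case: ifP => // le [<-] /=.
have := esym es2; rewrite catA => /cat_split.
rewrite size_cat => /(_ le) [x [ex ew]]; subst u1 w2.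
have e1 : u2 ++ bcod g2 ++ x ++ bdom g1 ++ w1 =
          (u2 ++ bcod g2 ++ x) ++ bdom g1 ++ w1 by rewrite !catA.
have e2 : (u2 ++ bdom g2 ++ x) ++ bcod g1 ++ w1 =
          u2 ++ bdom g2 ++ x ++ bcod g1 ++ w1 by rewrite !catA.
have e3 : (u2 ++ bcod g2 ++ x) ++ bcod g1 ++ w1 =
          u2 ++ bcod g2 ++ x ++ bcod g1 ++ w1 by rewrite !catA.
have [h3 eh3] : exists h : mor (wobj ((u2 ++ bcod g2 ++ x) ++ bcod g1 ++ w1))
                               (wobj t), Arr h = Arr h2.
  by exists (mcomp h2 (idto (congr1 wobj e3))); rewrite Arr_idr.
have S : denotes
    ((size ((u2 ++ bdom g2) ++ x) - size (bdom g2) + size (bcod g2), i1) :: d)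
    (mcomp h3 (whisk (u2 ++ bcod g2 ++ x) w1 (bmor g1))).
  exists (u2 ++ bcod g2 ++ x), w1, h3; split=> //; first by rewrite !size_cat; lia.
  exact: denotes_Arr sh2.
exists u2, (x ++ bdom g1 ++ w1), (mcomp
  (mcomp h3 (whisk (u2 ++ bcod g2 ++ x) w1 (bmor g1))) (idto (congr1 wobj e1))).
split=> //; first by rewrite !catA.
  by refine (denotes_Arr (esym e1) erefl _ S); rewrite Arr_idr.
rewrite ef.
transitivity (Arr (mcomp h2 (mcomp (whisk u2 (x ++ bcod g1 ++ w1) (bmor g2))
   (mcomp (idto (congr1 wobj e2)) (whisk (u2 ++ bdom g2 ++ x) w1 (bmor g1)))))).
  rewrite !mcompA; apply: Arr_comp; last by rewrite Arr_idr.
  by rewrite !Arr_whisk !arr_id_cat !arr_tenA.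
rewrite -!mcompA.
apply: Arr_comp; last by rewrite eh3.
by rewrite -whisk_interchange.
Qed.

Lemma denotes_word_after d s t f : @denotes d s t f -> word_after types d s = t.
Proof.
elim: d s f => [|[k i] d IH] s f /=; first by case.
have [-> ->] := typesP i.
case=> u [w [h [eu es sh _]]]; rewrite es -eu take_size_cat //.
by rewrite [in drop _ _]catA drop_size_cat ?size_cat //; apply: IH sh.
Qed.

Definition valid (r : rule) := exists t f,
  @denotes (rlhs r) (rdom r) t f /\ @denotes (rrhs r) (rdom r) t f.

Variable rules : seq rule.
Hypothesis rulesP : forall i, valid (nth rule0 rules i).

Lemma stepP o d s t f : @denotes d s t f -> denotes (step types rules s o d) f.
Proof.
case: o => [b n|i n k] /=.
  case ed: (drop n d) => [|x [|y d']] //.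
  case el: (exchange types b x y) => [l|] // sd.
  have := sd; rewrite -{1}(cat_take_drop n d) ed => /denotes_cat_inv.
  case=> s' [f1 [f2 [s1 s2 ->]]].
  by apply: denotes_cat s1 _; apply: denotes_exchange el s2.
case: ifP => // /andP[/andP[/eqP er le] /eqP el] sd.
have := sd; rewrite -{1}(cat_take_drop n d) => /denotes_cat_inv.
case=> s' [f1 [f2 [s1 s2 ->]]].
rewrite (denotes_word_after s1) in er le.
apply: denotes_cat s1 _.
move: s2; rewrite -{1}(cat_take_drop (size (rlhs (nth rule0 rules i))) (drop n d)).
rewrite el drop_drop addnC => /denotes_cat_inv [r [g1 [g2 [sg1 sg2 ->]]]].
apply: denotes_cat sg2.
have [t' [h [sl sr]]] := rulesP i.
set R := nth rule0 rules i in er el sl sr sg1 *.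
have es : s' = take k s' ++ rdom R ++ drop (size (rdom R)) (drop k s').
  by rewrite -[X in _ ++ X ++ _]er !cat_take_drop.
have ek : size (take k s') = k by rewrite size_take_min; apply/minn_idPl.
have wl := denotes_whisk (take k s') (drop (size (rdom R)) (drop k s')) sl.
have wr := denotes_whisk (take k s') (drop (size (rdom R)) (drop k s')) sr.
rewrite ek in wl wr.
have sg1' := denotes_Arr es erefl
  (esym (Arr_idr (congr1 wobj (esym es)) g1)) sg1.
have [er' eg] := denotes_det sg1' wl.
rewrite Arr_idr in eg.
exact: denotes_Arr (esym es) (esym er') (esym eg) wr.
Qed.

Lemma stepsP os d s t f :
  @denotes d s t f -> denotes (steps types rules s os d) f.
Proof. by elim: os d => [|o os IH] d //= sd; apply: IH; apply: stepP. Qed.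

End Semantics.

(** * Search for a rewriting sequence *)

(** The search needs no proof: it returns a list of operations, and any list
    of operations is sound. *)
Section Search.
Variable types : seq (seq nat * seq nat).
Local Notation state := (diag * seq op)%type.

Definition try_exchange (b : bool) (n : nat) (st : state) : option state :=
  if drop n st.1 is x :: y :: d' then
    if exchange types b x y is Some l then
      Some (take n st.1 ++ l ++ d', Exchange b n :: st.2)
    else None
  else None.

(** Brings the slice [p + k] to the place [p]; [b] is only the preferred side
    in ambiguous exchanges. *)
Fixpoint pull (b : bool) (p k : nat) (st : state) : option state :=
  if k is k'.+1 then
    if try_exchange b (p + k') st is Some st' then pull b p k' st'
    else if try_exchange (~~ b) (p + k') st is Some st' then pull b p k' st'
    else None
  else Some st.

(** The first [c] slices of [L] stand at the places [p], ..., [p + c - 1]; the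
    slice number [q] is appended to them if it is the next slice of [L], else
    moved before them, else skipped. *)
Fixpoint grow (fuel : nat) (L : diag) (p c q : nat) (st : state) :
    option (state * nat) :=
  if c == size L then Some (st, p) else
  if fuel is fuel'.+1 then
    if size st.1 <= q then None else
    let want := ((slice st.1 p).1 - (slice L 0).1 + (slice L c).1,
                 (slice L c).2) in
    let try b :=
      if pull b (p + c) (q - (p + c)) st is Some st' then
        if slice st'.1 (p + c) == want then Some st' else None
      else None in
    match try false with
    | Some st' => grow fuel' L p c.+1 q.+1 st'
    | None =>
      match try true with
      | Some st' => grow fuel' L p c.+1 q.+1 st'
      | None =>
        match pull false p (q - p) st with
        | Some st' => grow fuel' L p.+1 c q.+1 st'
        | None => grow fuel' L p c q.+1 st
        end
      end
    end
  else None.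

(** The reorderings of a diagram, each with the exchanges that lead back. *)
Fixpoint reorderings (fuel : nat) (todo seen : seq state) : seq state :=
  if fuel is fuel'.+1 then
    if todo is (L, os) :: todo' then
      let nexts := pmap (fun bn : bool * nat =>
          if try_exchange bn.1 bn.2 (L, [::]) is Some (L', _) then
            Some (L', Exchange (~~ bn.1) bn.2 :: os) else None)
        [seq (b, n) | b <- [:: false; true], n <- iota 0 (size L).-1] in
      let fresh := foldl (fun (acc : seq state) x =>
        if x.1 \in [seq y.1 | y <- acc ++ todo ++ seen] then acc
        else rcons acc x) [::] nexts in
      reorderings fuel' (todo' ++ fresh) ((L, os) :: seen)
    else seen
  else todo ++ seen.

Definition op_shift p o := if o is Exchange b n then Exchange b (p + n) else o.

Fixpoint first (A B : Type) (f : A -> option B) (l : seq A) : option B :=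
  if l is x :: l' then if f x is Some y then Some y else first f l' else None.

Definition find_at (L : diag) (d : diag) (p : nat) : option (state * nat) :=
  if ((slice d p).2 == (slice L 0).2) && ((slice L 0).1 <= (slice d p).1) then
    grow (size d) L p 1 p.+1 (d, [::])
  else None.

Variable rules : seq rule.
Variable s : seq nat.

Definition find (i : nat) (Ls : seq state) (d : diag) : option (seq op) :=
  let lhs := rlhs (nth rule0 rules i) in
  if ~~ all (fun x => x.2 \in [seq y.2 | y <- d]) lhs then None else
  first (fun Lo : state =>
    first (fun p =>
      if find_at Lo.1 d p is Some (st, p') then
        let os := rev st.2 ++ [seq op_shift p' o | o <- Lo.2] in
        let d' := steps types rules s os d in
        let k := (slice d' p').1 - (slice lhs 0).1 in
        let os' := rcons os (Replace i p' k) in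
        let d'' := steps types rules s os' d in
        if d'' == d' then None else Some os'
      else None) (iota 0 (size d))) Ls.

Fixpoint normalization (fuel : nat) (ils : seq (nat * seq state)) (d : diag) :
    seq op :=
  if fuel is fuel'.+1 then
    if first (fun il => find il.1 il.2 d) ils is Some os then
      os ++ normalization fuel' ils (steps types rules s os d)
    else [::]
  else [::].

Definition all_reorderings :=
  [seq (i, reorderings 60 [:: (rlhs (nth rule0 rules i), [::])] [::])
     | i <- iota 0 (size rules)].

Definition normal (d : diag) :=
  steps types rules s (normalization 100 all_reorderings d) d.

Fixpoint alignment (fuel : nat) (i : nat) (st : state) (tgt : diag) : state :=
  if fuel is fuel'.+1 then
    let f (bq : bool * nat) :=
      if pull bq.1 i (bq.2 - i) st is Some st' then
        if slice st'.1 i == slice tgt i then Some st' else None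
      else None in
    if first f [seq (b, q) | q <- iota i (size st.1 - i), b <- [:: false; true]]
      is Some st' then alignment fuel' i.+1 st' tgt
    else st
  else st.

Definition aligned (d tgt : diag) :=
  steps types rules s (rev (alignment (size d) 0 (d, [::]) tgt).2) d.

Definition same_normal_form (d1 d2 : diag) : bool :=
  let d2' := normal d2 in aligned (normal d1) d2' == d2'.

End Search.

(** * Reification *)

Section Reify.
Variables (M : strict_monoidal) (v : nat -> M) (boxes : seq (box v)).
Local Notation bx := (nth (box0 v) boxes).

Definition coded (S T : seq M) (f : S --> T) (s t : seq nat) (d : diag) :=
  exists2 f0 : mor (wobj v s) (wobj v t), denotes boxes d f0
    & @Arr M (word S) (word T) f = Arr f0.

Lemma coded_id s : coded (wid (map v s)) s s [::].
Proof. by exists (idm _). Qed.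

Lemma coded_box i : @coded (map v (bdom (bx i))) (map v (bcod (bx i)))
  (bmor (bx i)) (bdom (bx i)) (bcod (bx i)) [:: (0, i)].
Proof.
exists (bmor (bx i)) => //=; exists [::], [::].
exists (idto (congr1 (wobj v) (cats0 (bcod (bx i))))); split; rewrite ?cats0 //.
  split; rewrite ?cats0 //; rewrite Arr_idto; apply: Arr_idm.
  by rewrite cats0.
have e := Arr_whisk [::] [::] (bmor (bx i)).
rewrite arr_ten1l arr_ten1r in e.
by rewrite Arr_idl e.
Qed.

Lemma coded_comp S T U (f : S --> T) (g : T --> U) s t u d d' :
  coded f s t d -> coded g t u d' -> coded (g ∘ f) s u (d ++ d').
Proof.
move=> [f0 sf ef] [g0 sg eg]; exists (mcomp g0 f0); first exact: denotes_cat sf sg.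
exact: Arr_comp.
Qed.

Lemma retype a b a' b' (f : mor (wobj v a) (wobj v b)) : a = a' -> b = b' ->
  exists f' : mor (wobj v a') (wobj v b'), Arr f = Arr f'.
Proof. by move=> <- <-; exists f. Qed.

Lemma coded_ten S S' T T' (f : S --> T) (g : S' --> T') s t s' t' d d' :
  coded f s t d -> coded g s' t' d' ->
  coded (f ⊗ g) (s ++ s') (t ++ t') (d ++ shift (size t) d').
Proof.
move=> [f0 sf ef] [g0 sg eg].
have sf' : denotes boxes d (whisk [::] s' f0).
  move: (denotes_whisk [::] s' sf).
  by rewrite /= /shift (@eq_map _ _ _ id) ?map_id // => -[].
have [g1 eg1] := retype (whisk t [::] g0) (congr1 (cat t) (cats0 s'))
                        (congr1 (cat t) (cats0 t')).
have sg' := denotes_Arr (congr1 (cat t) (cats0 s')) (congr1 (cat t) (cats0 t'))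
  eg1 (denotes_whisk t [::] sg).
exists (mcomp g1 (whisk [::] s' f0)); first exact: denotes_cat sf' sg'.
rewrite Arr_wten ef eg.
transitivity (Arr (mcomp (tenm (idm (wobj v t)) g0) (tenm f0 (idm (wobj v s'))))).
  by rewrite -tenm_comp mcomp1m mcompm1.
apply: Arr_comp; first exact: esym (etrans (Arr_whisk [::] s' f0) (arr_ten1l _)).
by rewrite -eg1 Arr_whisk arr_ten1r.
Qed.

Inductive all_valid : seq rule -> Prop :=
| all_valid_nil : all_valid [::]
| all_valid_cons r rs : valid boxes r -> all_valid rs -> all_valid (r :: rs).

Lemma all_validP rs : all_valid rs -> forall i, valid boxes (nth rule0 rs i).
Proof.
elim=> [|r l vr _ IH] [|i] //=; by exists [::], (idm _).
Qed.

Lemma rule_valid S T (f g : S --> T) s t d d' :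
  coded f s t d -> coded g s t d' -> f = g -> valid boxes (Rule s d d').
Proof.
move=> [f0 sf ef] [g0 sg eg] e; subst g; exists t, f0; split=> //=.
by rewrite (Arr_inj (etrans (esym ef) eg)).
Qed.

Lemma strings_sound types rs S T (f g : S --> T) s t t' d d' :
  types = [seq (bdom x, bcod x) | x <- boxes] -> all_valid rs ->
  coded f s t d -> coded g s t' d' ->
  same_normal_form types rs s d d' = true -> f = g.
Proof.
move=> et /all_validP vs [f0 sf ef] [g0 sg eg] /eqP.
rewrite /aligned /normal => e; apply: Arr_inj; rewrite ef eg.
have P d1 t1 (f1 : mor (wobj v s) (wobj v t1)) os :=
  @stepsP M v boxes types et rs vs os d1 s t1 f1.
have := P _ _ _ (normalization types rs s 100 (all_reorderings types rs) d') sg.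
rewrite -e => sg'.
have sf' := P _ _ _ _
  (P _ _ _ (normalization types rs s 100 (all_reorderings types rs) d) sf).
by have [] := denotes_det (sf' _) sg'.
Qed.

End Reify.

(* Lists of terms of various types are nested pairs that end in tt. *)
Ltac mem_term x l :=
  lazymatch l with
  | tt => constr:(false)
  | (?y, ?l') =>
      lazymatch x with y => constr:(true) | _ => mem_term x l' end
  end.

Ltac add_term x l :=
  lazymatch mem_term x l with true => l | false => constr:((x, l)) end.

Ltac index_term x l :=
  lazymatch l with
  | (?y, ?l') =>
      lazymatch x with
      | y => constr:(0)
      | _ => let n := index_term x l' in constr:(n.+1)
      end
  end.

Ltac add_word w l :=
  lazymatch w with
  | nil => l
  | cons ?X ?w' => let l' := add_term X l in add_word w' l'
  end.

Ltac code_word objs w :=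
  lazymatch w with
  | nil => constr:(@nil nat)
  | cons ?X ?w' =>
      let i := index_term X objs in
      let r := code_word objs w' in constr:(cons i r)
  end.

Ltac eval_word w := eval cbn [cat] in w.
Ltac dom_word f := lazymatch type of f with @wmor _ ?s _ => eval_word s end.
Ltac cod_word f := lazymatch type of f with @wmor _ _ ?s => eval_word s end.

Ltac collect_boxes f l :=
  lazymatch f with
  | @wcomp _ _ _ _ ?g ?h =>
      let l' := collect_boxes h l in collect_boxes g l'
  | @wten _ _ _ _ _ ?g ?h =>
      let l' := collect_boxes g l in collect_boxes h l'
  | @wid _ _ => l
  | _ => add_term f l
  end.

Ltac collect_objects f l :=
  lazymatch f with
  | @wcomp _ _ _ _ ?g ?h =>
      let l' := collect_objects h l in collect_objects g l'
  | @wten _ _ _ _ _ ?g ?h =>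
      let l' := collect_objects g l in collect_objects h l'
  | @wid _ ?s => let s' := eval_word s in add_word s' l
  | _ =>
      let s := dom_word f in let t := cod_word f in
      let l' := add_word s l in add_word t l'
  end.

Ltac pair_of r :=
  let r' := eval hnf in r in
  lazymatch r' with
  | (_, _) => r'
  | _ => constr:((fst r, snd r))
  end.

Ltac collect_in_rules collect r l :=
  lazymatch r with
  | (?a, ?b) =>
      let l' := collect_in_rules collect a l in collect_in_rules collect b l'
  | tt => l
  | _ =>
    lazymatch type of r with
    | prod _ _ => let r' := pair_of r in collect_in_rules collect r' l
    | @eq _ ?f ?g => let l' := collect f l in collect g l'
    end
  end.

Ltac object_seq C l :=
  lazymatch l with
  | tt => constr:(@nil C)
  | (?x, ?l') => let r := object_seq C l' in constr:(@cons C x r)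
  end.

Ltac box_seq M v objs l :=
  lazymatch l with
  | tt => constr:(@nil (@box M v))
  | (?x, ?l') =>
      let s := dom_word x in let t := cod_word x in
      let cs := code_word objs s in let ct := code_word objs t in
      let r := box_seq M v objs l' in
      constr:(@cons (@box M v) (@Box M v cs ct x) r)
  end.

Ltac type_seq objs l :=
  lazymatch l with
  | tt => constr:(@nil (seq nat * seq nat))
  | (?x, ?l') =>
      let s := dom_word x in let t := cod_word x in
      let cs := code_word objs s in let ct := code_word objs t in
      let r := type_seq objs l' in
      constr:(cons (cs, ct) r)
  end.

Ltac reify M v bs objs ats f :=
  lazymatch f with
  | @wcomp _ _ _ _ ?g ?h =>
      let a := reify M v bs objs ats h in
      let b := reify M v bs objs ats g in
      constr:(coded_comp a b)
  | @wten _ _ _ _ _ ?g ?h =>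
      let a := reify M v bs objs ats g in
      let b := reify M v bs objs ats h in
      constr:(coded_ten a b)
  | @wid _ ?s =>
      let s' := eval_word s in
      let c := code_word objs s' in
      constr:(@coded_id M v bs c : @coded M v bs _ _ (wid s') c c nil)
  | _ =>
      let i := index_term f ats in
      let s := dom_word f in let t := cod_word f in
      let cs := code_word objs s in let ct := code_word objs t in
      constr:(@coded_box M v bs i :
                @coded M v bs s t f cs ct (cons (0, i) nil))
  end.

Ltac reify_rules M v bs objs ats r k :=
  lazymatch r with
  | (?a, ?b) =>
     let k' := reify_rules M v bs objs ats b k in
     reify_rules M v bs objs ats a k'
  | tt => k
  | _ =>
    lazymatch type of r with
    | prod _ _ => let r' := pair_of r in reify_rules M v bs objs ats r' k
    | @eq _ ?f ?g =>
       let a := reify M v bs objs ats f in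
       let b := reify M v bs objs ats g in
       constr:(all_valid_cons (rule_valid a b r) k)
    end
  end.

Ltac strings_with r :=
  lazymatch goal with
  | |- @eq (@wmor ?M _ _) ?f ?g =>
      let ats := collect_boxes f tt in
      let ats := collect_boxes g ats in
      let ats := collect_in_rules collect_boxes r ats in
      let objs := collect_objects f tt in
      let objs := collect_objects g objs in
      let objs := collect_in_rules collect_objects r objs in
      let C := constr:(obj (smcat M)) in
      let os := object_seq C objs in
      let v := fresh "v" in
      pose (v := fun i : nat => nth (@unit_obj M) os i);
      let bs' := box_seq M v objs ats in
      let bs := fresh "bs" in
      pose (bs := bs');
      let ts := type_seq objs ats in
      let a := reify M v bs objs ats f in
      let b := reify M v bs objs ats g in
      let vs := reify_rules M v bs objs ats r (@all_valid_nil M v bs) in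
      refine (@strings_sound M v bs ts _ _ _ _ _ _ _ _ _ _ erefl vs a b _);
      vm_compute; reflexivity
  end.

(** [strings r] proves an equation between morphisms; [r] is an equation or a
    tuple of equations.  Both sides are rewritten with them from left to right,
    the earlier ones in the tuple being tried first, modulo the interchange
    law; the results have to agree up to the interchange law. *)
Tactic Notation "strings" constr(r) := strings_with r.
Tactic Notation "strings" := strings_with tt.

(** * Naturality of the braiding *)

Section Braiding.
Variable C : strict_braided.
Local Notation ar f := (@Arr C _ _ f).

Lemma Arr_wbraid (s t : seq C) : ar (wbraid s t) = ar (braid (word s) (word t)).
Proof. by rewrite /wbraid Arr_idl Arr_idr. Qed.

Lemma wbraid_natural (s s' t t' : seq C) (f : s --> s') (g : t --> t') :
  Ψ s' t' ∘ (f ⊗ g) = (g ⊗ f) ∘ Ψ s t.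
Proof.
apply: (@Arr_inj C).
transitivity (ar (mcomp (braid (word s') (word t')) (tenm f g))).
  by apply: Arr_comp; rewrite ?Arr_wbraid ?Arr_wten.
rewrite braid_natural.
by apply: Arr_comp; rewrite ?Arr_wbraid ?Arr_wten.
Qed.

Lemma Arr_braid_tenr (X Y Z : C) :
  ar (braid X (ten Y Z)) = ar (mcomp (tenm (idm Y) (braid X Z))
     (mcomp (idto (tenA Y X Z)) (tenm (braid X Y) (idm Z)))).
Proof. by rewrite -braid_hexagon_r Arr_idl Arr_idr. Qed.

Lemma Arr_braid_tenl (X Y Z : C) :
  ar (braid (ten X Y) Z) = ar (mcomp (tenm (braid X Z) (idm Y))
      (mcomp (idto (esym (tenA X Z Y))) (tenm (idm X) (braid Y Z)))).
Proof. by rewrite -braid_hexagon_l Arr_idl Arr_idr. Qed.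

Lemma wbraid_catr (X Y Z : C) :
  Ψ [:: X] [:: Y; Z] =
  (wid [:: Y] ⊗ Ψ [:: X] [:: Z]) ∘ (Ψ [:: X] [:: Y] ⊗ wid [:: Z]).
Proof.
apply: (@Arr_inj C); rewrite Arr_wbraid Arr_braid_tenr /wcomp mcompA.
apply: Arr_comp.
  apply: esym (etrans (Arr_wten (Ψ [:: X] [:: Y]) (wid [:: Z])) _).
  by rewrite Arr_wbraid.
rewrite Arr_idr.
apply: esym (etrans (Arr_wten (wid [:: Y]) (Ψ [:: X] [:: Z])) _).
by rewrite Arr_wbraid.
Qed.

Lemma wbraid_catl (X Y Z : C) :
  Ψ [:: X; Y] [:: Z] =
  (Ψ [:: X] [:: Z] ⊗ wid [:: Y]) ∘ (wid [:: X] ⊗ Ψ [:: Y] [:: Z]).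
Proof.
apply: (@Arr_inj C); rewrite Arr_wbraid Arr_braid_tenl /wcomp mcompA.
apply: Arr_comp.
  apply: esym (etrans (Arr_wten (wid [:: X]) (Ψ [:: Y] [:: Z])) _).
  by rewrite Arr_wbraid.
rewrite Arr_idr.
apply: esym (etrans (Arr_wten (Ψ [:: X] [:: Z]) (wid [:: Y])) _).
by rewrite Arr_wbraid.
Qed.

Lemma idempotent_braid_id (X Y : C) (e : ten Y X = ten X Y):
  ar (mcomp (braid X Y) (mcomp (idto e) (braid X Y))) = ar (braid X Y) ->
  ar (braid X Y) = ar (idm (ten X Y)).
Proof.
have [g [gb bg]] := braid_iso X Y => h.
have -> : ar (idm (ten X Y)) = ar (mcomp g (braid X Y)) by rewrite gb.
have -> : ar (braid X Y) = ar (mcomp (idto e) (braid X Y)) by rewrite Arr_idl.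
transitivity (ar (mcomp g (mcomp (braid X Y) (mcomp (idto e) (braid X Y))))).
  by rewrite mcompA gb mcomp1m.
exact: Arr_comp.
Qed.

(** By the hexagon for [X], [1], [1], the braiding with the unit object is
    idempotent; being invertible, it is an identity. *)
Lemma wbraid_unitr (X : C) : Ψ [:: X] [::] = wid [:: X].
Proof.
apply: (@Arr_inj C); rewrite Arr_wbraid /=.
have e0 : ten unit_obj X = ten X unit_obj :> C by rewrite ten1o teno1.
rewrite (idempotent_braid_id (e := e0)) ?(Arr_idm (teno1 X)) //.
rewrite -[RHS](congr1 (fun Y => ar (braid X Y)) (ten1o unit_obj)) Arr_braid_tenr.
apply: Arr_comp.
  by rewrite !Arr_idl -[LHS]arr_ten1r.
by rewrite -[LHS]arr_ten1l.
Qed.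

Lemma wbraid_unitl (X : C) : Ψ [::] [:: X] = wid [:: X].
Proof.
apply: (@Arr_inj C); rewrite Arr_wbraid /=.
have e0 : ten X unit_obj = ten unit_obj X :> C by rewrite ten1o teno1.
rewrite (idempotent_braid_id (e := e0)) ?(Arr_idm (ten1o X)) //.
rewrite -[RHS](congr1 (fun Y => ar (braid Y X)) (ten1o unit_obj)) Arr_braid_tenl.
apply: Arr_comp.
  by rewrite !Arr_idl -[LHS]arr_ten1l.
by rewrite -[LHS]arr_ten1r.
Qed.

Lemma wbraid_inv (A : C) : exists k : [:: A; A] --> [:: A; A],
  k ∘ Ψ [:: A] [:: A] = wid [:: A; A].
Proof.
have [k [k1 _]] := braid_iso A A.
exists k; apply: (@Arr_inj C); rewrite -[RHS](congr1 (fun x => ar x) k1).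
by apply: Arr_comp => //; rewrite Arr_wbraid.
Qed.

(** In the names below the digits are the numbers of inputs and outputs of the
    box; [l] and [r] tell on which side of the strand [X] it starts. *)
Variables (X A A' D : C).
Local Notation "1" := (wid [:: X]).
Implicit Types (e : [:: A] --> [::]) (u : [::] --> [:: A]) (f : [:: A] --> [:: A'])
  (m : [:: A; A'] --> [:: D]) (d : [:: D] --> [:: A; A']).

Lemma braid01l u : Ψ [:: A] [:: X] ∘ (u ⊗ 1) = 1 ⊗ u.
Proof. rewrite (wbraid_natural u 1) wbraid_unitl; strings. Qed.

Lemma braid01r u : Ψ [:: X] [:: A] ∘ (1 ⊗ u) = u ⊗ 1.
Proof. rewrite (wbraid_natural 1 u) wbraid_unitr; strings. Qed.

Lemma braid10l e : (1 ⊗ e) ∘ Ψ [:: A] [:: X] = e ⊗ 1.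
Proof. rewrite -(wbraid_natural e 1) wbraid_unitl; strings. Qed.

Lemma braid10r e : (e ⊗ 1) ∘ Ψ [:: X] [:: A] = 1 ⊗ e.
Proof. rewrite -(wbraid_natural 1 e) wbraid_unitr; strings. Qed.

Lemma braid11l f : Ψ [:: A'] [:: X] ∘ (f ⊗ 1) = (1 ⊗ f) ∘ Ψ [:: A] [:: X].
Proof. exact: wbraid_natural. Qed.

Lemma braid11r f : Ψ [:: X] [:: A'] ∘ (1 ⊗ f) = (f ⊗ 1) ∘ Ψ [:: X] [:: A].
Proof. exact: wbraid_natural. Qed.

Lemma braid21l m : Ψ [:: D] [:: X] ∘ (m ⊗ 1) =
  (1 ⊗ m) ∘ (Ψ [:: A] [:: X] ⊗ wid [:: A']) ∘ (wid [:: A] ⊗ Ψ [:: A'] [:: X]).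
Proof. by rewrite (wbraid_natural m 1) wbraid_catl. Qed.

Lemma braid21r m : Ψ [:: X] [:: D] ∘ (1 ⊗ m) =
  (m ⊗ 1) ∘ (wid [:: A] ⊗ Ψ [:: X] [:: A']) ∘ (Ψ [:: X] [:: A] ⊗ wid [:: A']).
Proof. by rewrite (wbraid_natural 1 m) wbraid_catr. Qed.

Lemma braid12l d : (1 ⊗ d) ∘ Ψ [:: D] [:: X] =
  (Ψ [:: A] [:: X] ⊗ wid [:: A']) ∘ (wid [:: A] ⊗ Ψ [:: A'] [:: X]) ∘ (d ⊗ 1).
Proof. rewrite -(wbraid_natural d 1) wbraid_catl; strings. Qed.

Lemma braid12r d : (d ⊗ 1) ∘ Ψ [:: X] [:: D] =
  (wid [:: A] ⊗ Ψ [:: X] [:: A']) ∘ (Ψ [:: X] [:: A] ⊗ wid [:: A']) ∘ (1 ⊗ d).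
Proof. rewrite -(wbraid_natural 1 d) wbraid_catr; strings. Qed.

End Braiding.

(** * The axioms of a bialgebra *)

Section Bialgebra.
Context (C : strict_braided) (B : bialgebra C).
Local Notation m := (bmul B).
Local Notation η := (bunit B).
Local Notation Δ := (bcomul B).
Local Notation ε := (bcounit B).
Local Notation Ψ0 := (Ψ [:: bobj B] [:: bobj B]).
Local Notation "1" := (wid [:: bobj B]).

Lemma mulA : m ∘ (m ⊗ 1) = m ∘ (1 ⊗ m).
Proof. by case: (bialgebraP B) => -[]. Qed.

Lemma mul1l : m ∘ (η ⊗ 1) = 1.
Proof. by case: (bialgebraP B) => -[]. Qed.

Lemma mul1r : m ∘ (1 ⊗ η) = 1.
Proof. by case: (bialgebraP B) => -[]. Qed.

Lemma comulA : (1 ⊗ Δ) ∘ Δ = (Δ ⊗ 1) ∘ Δ.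
Proof. by case: (bialgebraP B) => _ -[]. Qed.

Lemma comul1l : (ε ⊗ 1) ∘ Δ = 1.
Proof. by case: (bialgebraP B) => _ -[]. Qed.

Lemma comul1r : (1 ⊗ ε) ∘ Δ = 1.
Proof. by case: (bialgebraP B) => _ -[]. Qed.

Lemma comul_mul : Δ ∘ m = (m ⊗ m) ∘ (1 ⊗ Ψ0 ⊗ 1) ∘ (Δ ⊗ Δ).
Proof. case: (bialgebraP B) => _ _ [-> _] _; strings. Qed.

Lemma comul_unit : Δ ∘ η = η ⊗ η.
Proof. by case: (bialgebraP B) => _ _ []. Qed.

Lemma counit_mul : ε ∘ m = ε ⊗ ε.
Proof. case: (bialgebraP B) => _ _ _ [-> _]; rewrite /unit_mul; strings. Qed.

Lemma counit_unit : ε ∘ η = wid [::].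
Proof. by case: (bialgebraP B) => _ _ _ []. Qed.

End Bialgebra.

(** * Bialgebras that realize a tuple of structure maps *)

(** The projections of the third statement, together with the requirement that
    every structure map of [h] is the matching component of [B].  That the
    maps [i1], [p2] respect (co)units and (co)multiplications determines [m1],
    [η1], [Δ2] and [ε2], which is why those have no equation of their own. *)
Record realized (C : strict_braided) (B : bialgebra C) (h : hopf_maps C)
    (i1 : [:: hB1 h] --> [:: bobj B]) (p1 : [:: bobj B] --> [:: hB1 h])
    (i2 : [:: hB2 h] --> [:: bobj B]) (p2 : [:: bobj B] --> [:: hB2 h]) : Prop :=
  Realized {
  rz_i1_mul : i1 ∘ hm1 h = bmul B ∘ (i1 ⊗ i1);
  rz_i1_unit : i1 ∘ hη1 h = bunit B;
  rz_p2_comul : hΔ2 h ∘ p2 = (p2 ⊗ p2) ∘ bcomul B;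
  rz_p2_counit : hε2 h ∘ p2 = bcounit B;
  rz_p1_i1 : p1 ∘ i1 = wid [:: hB1 h];
  rz_p2_i2 : p2 ∘ i2 = wid [:: hB2 h];
  rz_gf : (p1 ⊗ p2) ∘ bcomul B ∘ bmul B ∘ (i1 ⊗ i2) = wid [:: hB1 h; hB2 h];
  rz_fg : bmul B ∘ (i1 ⊗ i2) ∘ (p1 ⊗ p2) ∘ bcomul B = wid [:: bobj B];
  rz_Δ1 : hΔ1 h = (p1 ⊗ p1) ∘ bcomul B ∘ i1;
  rz_ε1 : hε1 h = bcounit B ∘ i1;
  rz_m2 : hm2 h = p2 ∘ bmul B ∘ (i2 ⊗ i2);
  rz_η2 : hη2 h = p2 ∘ bunit B;
  rz_μl : hμl h = p1 ∘ bmul B ∘ (i2 ⊗ i1);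
  rz_μr : hμr h = p2 ∘ bmul B ∘ (i2 ⊗ i1);
  rz_νl : hνl h = (p2 ⊗ p1) ∘ bcomul B ∘ i1;
  rz_νr : hνr h = (p2 ⊗ p1) ∘ bcomul B ∘ i2;
  rz_ρ : hρ h = (p1 ⊗ p1) ∘ bcomul B ∘ i2;
  rz_σ : hσ h = p1 ∘ bmul B ∘ (i2 ⊗ i2) }.

Lemma equation_transport (M : strict_monoidal) (s t s' t' : seq M)
    (L R : s --> t) (l r : s' --> t')
    (a : t' --> t) (b : s --> s') (c : t --> t') (d : s' --> s) :
  L = a ∘ l ∘ b -> R = a ∘ r ∘ b -> l = c ∘ L ∘ d -> r = c ∘ R ∘ d ->
  (L = R <-> l = r).
Proof.
by move=> eL eR el er; split=> e; [rewrite el e -er | rewrite eL e -eR].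
Qed.

Section Realization.
Context (C : strict_braided) (B : bialgebra C) (h : hopf_maps C).
Context (i1 : [:: hB1 h] --> [:: bobj B]) (p1 : [:: bobj B] --> [:: hB1 h])
    (i2 : [:: hB2 h] --> [:: bobj B]) (p2 : [:: bobj B] --> [:: hB2 h]).
Hypothesis rz : realized i1 p1 i2 p2.
Local Notation A := (bobj B).
Local Notation m := (bmul B).
Local Notation η := (bunit B).
Local Notation Δ := (bcomul B).
Local Notation ε := (bcounit B).
Local Notation "1" := (wid [:: A]).
Local Notation B1 := (hB1 h).
Local Notation B2 := (hB2 h).
Local Notation m1 := (hm1 h).
Local Notation m2 := (hm2 h).
Local Notation η1 := (hη1 h).
Local Notation η2 := (hη2 h).
Local Notation Δ1 := (hΔ1 h).
Local Notation Δ2 := (hΔ2 h).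
Local Notation ε1 := (hε1 h).
Local Notation ε2 := (hε2 h).
Local Notation μl := (hμl h).
Local Notation μr := (hμr h).
Local Notation νl := (hνl h).
Local Notation νr := (hνr h).
Local Notation ρ := (hρ h).
Local Notation σ := (hσ h).
Local Notation id1 := (wid [:: B1]).
Local Notation id2 := (wid [:: B2]).
Local Notation Ψ0 := (Ψ [:: A] [:: A]).
Local Notation Ψ11 := (Ψ [:: B1] [:: B1]).
Local Notation Ψ12 := (Ψ [:: B1] [:: B2]).
Local Notation Ψ21 := (Ψ [:: B2] [:: B1]).
Local Notation Ψ22 := (Ψ [:: B2] [:: B2]).
Local Notation Π1 := (i1 ∘ p1).
Local Notation Π2 := (i2 ∘ p2).
Local Notation f := (m ∘ (i1 ⊗ i2)).
Local Notation g := ((p1 ⊗ p2) ∘ Δ).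

Let i1_mul := rz_i1_mul rz.
Let i1_unit := rz_i1_unit rz.
Let p2_comul := rz_p2_comul rz.
Let p2_counit := rz_p2_counit rz.
Let p1_i1 := rz_p1_i1 rz.
Let p2_i2 := rz_p2_i2 rz.
Let gf := rz_gf rz.
Let fg := rz_fg rz.

Lemma p1_unit : p1 ∘ η = η1.
Proof. rewrite -i1_unit; strings p1_i1. Qed.

Lemma i2_counit : ε ∘ i2 = ε2.
Proof. rewrite -p2_counit; strings p2_i2. Qed.

Lemma p2_unit : p2 ∘ η = η2.
Proof. by rewrite (rz_η2 rz). Qed.

Lemma i1_counit : ε ∘ i1 = ε1.
Proof. by rewrite (rz_ε1 rz). Qed.

(** [i2 ∘ p2 ∘ η] is [f ∘ g ∘ η], since [p1] already preserves the unit. *)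
Lemma i2_unit : i2 ∘ η2 = η.
Proof.
transitivity ((m ∘ (i1 ⊗ i2) ∘ (p1 ⊗ p2) ∘ Δ) ∘ η); last by strings fg.
strings (p1_unit, p2_unit, i1_unit, mul1l B, comul_unit B).
Qed.

Lemma p1_counit : ε1 ∘ p1 = ε.
Proof.
transitivity (ε ∘ (m ∘ (i1 ⊗ i2) ∘ (p1 ⊗ p2) ∘ Δ)); last by strings fg.
strings (i1_counit, i2_counit, p2_counit, comul1r B, counit_mul B).
Qed.

Lemma ε1_η1 : ε1 ∘ η1 = wid [::].
Proof. rewrite -p1_unit; strings (p1_counit, counit_unit B). Qed.

Lemma ε2_η2 : ε2 ∘ η2 = wid [::].
Proof. rewrite -p2_unit; strings (p2_counit, counit_unit B). Qed.

Lemma ε1_m1 : ε1 ∘ m1 = ε1 ⊗ ε1.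
Proof. rewrite -i1_counit; strings (i1_mul, counit_mul B). Qed.

Lemma Δ2_η2 : Δ2 ∘ η2 = η2 ⊗ η2.
Proof. rewrite -p2_unit; strings (p2_comul, comul_unit B). Qed.

Lemma m1_realized : m1 = p1 ∘ m ∘ (i1 ⊗ i1).
Proof. strings (esym i1_mul, p1_i1). Qed.

Lemma Δ2_realized : Δ2 = (p2 ⊗ p2) ∘ Δ ∘ i2.
Proof. transitivity (Δ2 ∘ p2 ∘ i2); [strings p2_i2 | strings p2_comul]. Qed.

Lemma p1_f : p1 ∘ m ∘ (i1 ⊗ i2) = id1 ⊗ ε2.
Proof.
transitivity ((id1 ⊗ ε2) ∘ ((p1 ⊗ p2) ∘ Δ ∘ m ∘ (i1 ⊗ i2))).
  strings (p2_counit, comul1r B).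
strings gf.
Qed.

Lemma p2_f : p2 ∘ m ∘ (i1 ⊗ i2) = ε1 ⊗ id2.
Proof.
transitivity ((ε1 ⊗ id2) ∘ ((p1 ⊗ p2) ∘ Δ ∘ m ∘ (i1 ⊗ i2))).
  strings (p1_counit, comul1l B).
strings gf.
Qed.

Lemma g_i1 : (p1 ⊗ p2) ∘ Δ ∘ i1 = id1 ⊗ η2.
Proof.
transitivity ((p1 ⊗ p2) ∘ Δ ∘ m ∘ (i1 ⊗ i2) ∘ (id1 ⊗ η2)).
  strings (i2_unit, mul1r B).
strings gf.
Qed.

Lemma g_i2 : (p1 ⊗ p2) ∘ Δ ∘ i2 = η1 ⊗ id2.
Proof.
transitivity ((p1 ⊗ p2) ∘ Δ ∘ m ∘ (i1 ⊗ i2) ∘ (η1 ⊗ id2)).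
  strings (i1_unit, mul1l B).
strings gf.
Qed.

Lemma p1_i2 : p1 ∘ i2 = η1 ∘ ε2.
Proof.
transitivity ((id1 ⊗ ε2) ∘ ((p1 ⊗ p2) ∘ Δ ∘ i2)).
  strings (p2_counit, comul1r B).
rewrite g_i2; strings.
Qed.

Lemma p2_i1 : p2 ∘ i1 = η2 ∘ ε1.
Proof.
transitivity ((ε1 ⊗ id2) ∘ ((p1 ⊗ p2) ∘ Δ ∘ i1)).
  strings (p1_counit, comul1l B).
rewrite g_i1; strings.
Qed.

(** The next four lemmas come from the same remark: [f] is left [B1]-linear
    because [i1] is multiplicative, and [g] is right [B2]-colinear because
    [p2] is comultiplicative; so their inverses are, and so are the
    components. *)
Lemma p2_mul_i1 : p2 ∘ m ∘ (i1 ⊗ 1) = ε1 ⊗ p2.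
Proof.
transitivity (p2 ∘ m ∘ (i1 ⊗ m ∘ (i1 ⊗ i2) ∘ (p1 ⊗ p2) ∘ Δ)).
  strings fg.
transitivity (p2 ∘ m ∘ (i1 ⊗ i2) ∘ (m1 ⊗ id2) ∘ (id1 ⊗ (p1 ⊗ p2) ∘ Δ)).
  strings (mulA B, i1_mul).
strings (p2_f, ε1_m1, p1_counit, comul1l B).
Qed.

Lemma p1_mul_i1 : p1 ∘ m ∘ (i1 ⊗ 1) = m1 ∘ (id1 ⊗ p1).
Proof.
transitivity (p1 ∘ m ∘ (i1 ⊗ m ∘ (i1 ⊗ i2) ∘ (p1 ⊗ p2) ∘ Δ)).
  strings fg.
transitivity (p1 ∘ m ∘ (i1 ⊗ i2) ∘ (m1 ⊗ id2) ∘ (id1 ⊗ (p1 ⊗ p2) ∘ Δ)).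
  strings (mulA B, i1_mul).
strings (p1_f, p2_counit, comul1r B).
Qed.

Lemma p2_comul_i1 : (1 ⊗ p2) ∘ Δ ∘ i1 = i1 ⊗ η2.
Proof.
transitivity ((m ∘ (i1 ⊗ i2) ∘ (p1 ⊗ p2) ∘ Δ ⊗ p2) ∘ Δ ∘ i1).
  strings fg.
transitivity ((m ∘ (i1 ⊗ i2) ⊗ id2) ∘ (id1 ⊗ Δ2) ∘ (p1 ⊗ p2) ∘ Δ ∘ i1).
  strings (comulA B, p2_comul).
strings (g_i1, Δ2_η2, i2_unit, mul1r B).
Qed.

Lemma p2_comul_i2 : (1 ⊗ p2) ∘ Δ ∘ i2 = (i2 ⊗ id2) ∘ Δ2.
Proof.
transitivity ((m ∘ (i1 ⊗ i2) ∘ (p1 ⊗ p2) ∘ Δ ⊗ p2) ∘ Δ ∘ i2).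
  strings fg.
transitivity ((m ∘ (i1 ⊗ i2) ⊗ id2) ∘ (id1 ⊗ Δ2) ∘ (p1 ⊗ p2) ∘ Δ ∘ i2).
  strings (comulA B, p2_comul).
strings (g_i2, i1_unit, mul1l B).
Qed.

(** Writing the left factor as the product of its two parts, the part in [B1]
    is killed by [p2_mul_i1]. *)
Lemma p2_mul_Π2 : p2 ∘ m ∘ (i2 ⊗ 1) ∘ (p2 ⊗ 1) = p2 ∘ m.
Proof.
symmetry; transitivity (p2 ∘ m ∘ (m ∘ (i1 ⊗ i2) ∘ (p1 ⊗ p2) ∘ Δ ⊗ 1)).
  strings fg.
strings (mulA B, p2_mul_i1, p1_counit, comul1l B).
Qed.

Lemma comul_i1_Π1 : (1 ⊗ i1) ∘ (1 ⊗ p1) ∘ Δ ∘ i1 = Δ ∘ i1.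
Proof.
symmetry; transitivity ((1 ⊗ m ∘ (i1 ⊗ i2) ∘ (p1 ⊗ p2) ∘ Δ) ∘ Δ ∘ i1).
  strings fg.
strings (comulA B, p2_comul_i1, i2_unit, mul1r B).
Qed.

Lemma p1_mul_Π1 : p1 ∘ m ∘ (i1 ⊗ i1) ∘ (id1 ⊗ p1) = p1 ∘ m ∘ (i1 ⊗ 1).
Proof. strings (p1_mul_i1, p1_i1). Qed.

Lemma comul_i2_Π2 : (i2 ⊗ id2) ∘ (p2 ⊗ p2) ∘ Δ ∘ i2 = (1 ⊗ p2) ∘ Δ ∘ i2.
Proof. strings (p2_comul_i2, p2_i2). Qed.

Lemma mul_i1_Π1 : i1 ∘ p1 ∘ m ∘ (i1 ⊗ 1) = m ∘ (i1 ⊗ i1 ∘ p1).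
Proof. strings (p1_mul_i1, i1_mul). Qed.

Let unit_rules := (i1_unit, i2_unit, p1_unit, p2_unit,
  i1_counit, i2_counit, p1_counit, p2_counit, p1_i1, p2_i2, p1_i2, p2_i1).

Let component_rules := (rz_Δ1 rz, rz_m2 rz, rz_μl rz, rz_μr rz,
  rz_νl rz, rz_νr rz, rz_ρ rz, rz_σ rz).

(* [lift] moves a box before the crossings that follow it, [sink] moves it
   behind them. *)
Let lift1 := (esym (braid11l B1 i1), esym (braid11l B2 i1), esym (braid11l A i1),
  esym (braid11r B1 i1), esym (braid11r B2 i1), esym (braid11r A i1),
  esym (braid11l B1 p1), esym (braid11l B2 p1), esym (braid11l A p1),
  esym (braid11r B1 p1), esym (braid11r B2 p1), esym (braid11r A p1)).
Let lift2 := (esym (braid11l B1 i2), esym (braid11l B2 i2), esym (braid11l A i2),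
  esym (braid11r B1 i2), esym (braid11r B2 i2), esym (braid11r A i2),
  esym (braid11l B1 p2), esym (braid11l B2 p2), esym (braid11l A p2),
  esym (braid11r B1 p2), esym (braid11r B2 p2), esym (braid11r A p2)).
Let sink1 := (braid11l B1 i1, braid11l B2 i1, braid11l A i1,
  braid11r B1 i1, braid11r B2 i1, braid11r A i1,
  braid11l B1 p1, braid11l B2 p1, braid11l A p1,
  braid11r B1 p1, braid11r B2 p1, braid11r A p1).
Let sink2 := (braid11l B1 i2, braid11l B2 i2, braid11l A i2,
  braid11r B1 i2, braid11r B2 i2, braid11r A i2,
  braid11l B1 p2, braid11l B2 p2, braid11l A p2,
  braid11r B1 p2, braid11r B2 p2, braid11r A p2).

(** * Projection relations and strong Hopf data *)

Lemma comul_braid_i1_Π1 :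
  (1 ⊗ 1 ⊗ i1) ∘ (1 ⊗ 1 ⊗ p1) ∘ (1 ⊗ Δ) ∘ Ψ0 ∘ (i1 ⊗ 1) =
  (1 ⊗ Δ) ∘ Ψ0 ∘ (i1 ⊗ 1).
Proof. strings (comul_i1_Π1, braid11l A i1). Qed.

Lemma p2_braid_mul_Π2 :
  (1 ⊗ p2) ∘ Ψ0 ∘ (m ⊗ 1) ∘ (i2 ⊗ 1 ⊗ 1) ∘ (p2 ⊗ 1 ⊗ 1) =
  (1 ⊗ p2) ∘ Ψ0 ∘ (m ⊗ 1).
Proof. strings (p2_mul_Π2, esym (braid11l A p2)). Qed.

(* A [Π1] is erased at the legs of [Δ ∘ i1], that is, before the crossings,
   and a [Π2] at the arguments of [p2 ∘ m], behind them. *)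
Let erase_rules := (p1_i1, p2_i2, p2_mul_Π2, comul_i1_Π1, p1_mul_Π1,
  comul_i2_Π2, lift1, sink2).
Let relation_rules := (component_rules, erase_rules, unit_rules).

(** Each relation [rel_P] below is obtained from the condition [hd_S] by
    composing with the [p]'s at the inputs and the [i]'s at the outputs, and
    conversely.  The inputs and outputs of [rel_P] without a [Π] in front of
    them do no harm: the missing [Π]'s can be inserted by [p2_mul_Π2] and
    [comul_i1_Π1]. *)
Lemma rel_P1_S1 :
  (Π2 ⊗ 1) ∘ Phi 1 ∘ (Π1 ⊗ Π1) = (Π2 ⊗ 1) ∘ Δ ∘ Π1 ⊗ ε <->
  (μr ⊗ id1) ∘ (id2 ⊗ Ψ11) ∘ (νl ⊗ id1) = νl ⊗ ε1.
Proof.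
by apply: (equation_transport (a := i2 ⊗ i1) (b := p1 ⊗ p1)
    (c := p2 ⊗ p1) (d := i1 ⊗ i1)); rewrite /Phi; strings relation_rules.
Qed.

Lemma rel_P1'_S2 :
  (Π2 ⊗ Π2) ∘ Phi' 1 ∘ (1 ⊗ Π1) = η ⊗ Π2 ∘ m ∘ (1 ⊗ Π1) <->
  (id2 ⊗ μr) ∘ (Ψ22 ⊗ id1) ∘ (id2 ⊗ νl) = η2 ⊗ μr.
Proof.
by apply: (equation_transport (a := i2 ⊗ i2) (b := p2 ⊗ p1)
    (c := p2 ⊗ p2) (d := i2 ⊗ i1)); rewrite /Phi'; strings relation_rules.
Qed.

Lemma rel_P2_S3 :
  ((Π1 ⊗ Π1) ∘ Phi Π2 ⊗ 1) ∘ (Π2 ⊗ Ψ0) ∘ (Δ ∘ Π1 ⊗ Π2) =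
  η ⊗ η ⊗ Π1 ⊗ ε <->
  (σ ⊗ id1 ⊗ id1) ∘ (id2 ⊗ Ψ12 ⊗ id1) ∘ (νr ⊗ Ψ12) ∘ (νl ⊗ id2) =
  η1 ⊗ η1 ⊗ id1 ⊗ ε2.
Proof.
by apply: (equation_transport (a := i1 ⊗ i1 ⊗ i1) (b := p1 ⊗ p2)
    (c := p1 ⊗ p1 ⊗ p1) (d := i1 ⊗ i2)); rewrite /Phi; strings relation_rules.
Qed.

Lemma rel_P2'_S4 :
  (Π1 ⊗ Π2 ∘ m) ∘ (Ψ0 ⊗ Π1) ∘ (1 ⊗ Phi' Π1 ∘ (Π2 ⊗ Π2)) =
  η ⊗ Π2 ⊗ ε ⊗ ε <->
  (id1 ⊗ μr) ∘ (Ψ21 ⊗ μl) ∘ (id2 ⊗ Ψ21 ⊗ id1) ∘ (id2 ⊗ id2 ⊗ ρ) =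
  η1 ⊗ id2 ⊗ ε2 ⊗ ε2.
Proof.
by apply: (equation_transport (a := i1 ⊗ i2) (b := p2 ⊗ p2 ⊗ p2)
    (c := p1 ⊗ p2) (d := i2 ⊗ i2 ⊗ i2)); rewrite /Phi'; strings relation_rules.
Qed.

Lemma rel_P3_S5 :
  (Π1 ∘ m ⊗ 1) ∘ (Π2 ⊗ Π2 ⊗ 1) ∘ (1 ⊗ Δ ∘ Π1) = η ∘ ε ⊗ Π1 <->
  (σ ⊗ id1) ∘ (id2 ⊗ νl) = η1 ∘ ε2 ⊗ id1.
Proof.
by apply: (equation_transport (a := i1 ⊗ i1) (b := p2 ⊗ p1)
    (c := p1 ⊗ p1) (d := i2 ⊗ i1)); strings relation_rules.
Qed.

Lemma rel_P3'_S6 :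
  (Π2 ∘ m ⊗ 1) ∘ (1 ⊗ Π1 ⊗ Π1) ∘ (1 ⊗ Δ ∘ Π2) = Π2 ⊗ η ∘ ε <->
  (μr ⊗ id1) ∘ (id2 ⊗ ρ) = id2 ⊗ η1 ∘ ε2.
Proof.
by apply: (equation_transport (a := i2 ⊗ i1) (b := p2 ⊗ p2)
    (c := p2 ⊗ p1) (d := i2 ⊗ i2)); strings relation_rules.
Qed.

Lemma rel_P4_S7 :
  (Π1 ⊗ Π2 ∘ m ∘ (1 ⊗ Π1) ⊗ 1 ⊗ Π1) ∘ (Ψ0 ⊗ Phi Π2 ⊗ 1) ∘
    (1 ⊗ Ψ0 ⊗ 1 ⊗ 1) ∘ (1 ⊗ Π1 ⊗ (Δ ∘ Π1 ⊗ 1) ∘ Δ ∘ Π2) =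
  (Π1 ⊗ Π2 ∘ m ⊗ Π1 ⊗ Π1) ∘ (Ψ0 ⊗ 1 ⊗ 1 ⊗ 1) ∘ (1 ⊗ Δ ⊗ 1 ⊗ 1) ∘
    (1 ⊗ Ψ0 ⊗ 1) ∘ (1 ⊗ 1 ⊗ (Π1 ⊗ 1) ∘ Δ ∘ Π2) <->
  (id1 ⊗ μr ∘ (id2 ⊗ μl) ⊗ id1 ⊗ id1) ∘
    (id1 ⊗ id2 ⊗ id2 ⊗ Ψ11 ⊗ id1) ∘ (Ψ21 ⊗ νl ⊗ id1 ⊗ id1) ∘ hξ h =
  (id1 ⊗ μr ⊗ id1 ⊗ id1) ∘ (Ψ21 ⊗ Ψ11 ⊗ id1) ∘ hξ h.
Proof.
apply: (equation_transport (a := i1 ⊗ i2 ⊗ i1 ⊗ i1) (b := p2 ⊗ p1 ⊗ p2)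
    (c := p1 ⊗ p2 ⊗ p1 ⊗ p1) (d := i2 ⊗ i1 ⊗ i2)); rewrite /Phi /hξ.
- strings (relation_rules, comul_braid_i1_Π1).
- strings (relation_rules, braid12r A Δ).
- strings (relation_rules, comul_braid_i1_Π1).
- strings (relation_rules, braid12r A Δ, braid12r B1 Δ).
Qed.

Lemma rel_P4'_S8 :
  (Π1 ∘ m ∘ (1 ⊗ Π2 ∘ m) ⊗ Π2 ⊗ 1) ∘ (1 ⊗ 1 ⊗ Ψ0 ⊗ 1) ∘
    (1 ⊗ Phi' Π1 ⊗ Ψ0) ∘ (Π2 ⊗ 1 ⊗ (Π2 ⊗ 1) ∘ Δ ∘ Π1 ⊗ Π2) =
  (Π1 ∘ m ∘ (1 ⊗ Π2) ⊗ 1 ⊗ 1) ∘ (1 ⊗ Ψ0 ⊗ 1) ∘ (1 ⊗ 1 ⊗ m ⊗ 1) ∘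
    (1 ⊗ 1 ⊗ 1 ⊗ Ψ0) ∘ (Π2 ⊗ Π2 ⊗ Δ ∘ Π1 ⊗ Π2) <->
  hχ h ∘ (id2 ⊗ id2 ⊗ μr ⊗ Ψ12) ∘ (id2 ⊗ Ψ22 ⊗ id1 ⊗ id1 ⊗ id2) ∘
    (id2 ⊗ id2 ⊗ νr ⊗ id1 ⊗ id2) ∘ (id2 ⊗ id2 ⊗ νl ⊗ id2) =
  hχ h ∘ (id2 ⊗ Ψ22 ⊗ Ψ12) ∘ (id2 ⊗ id2 ⊗ νl ⊗ id2).
Proof.
apply: (equation_transport (a := i1 ⊗ i2 ⊗ i1) (b := p2 ⊗ p2 ⊗ p1 ⊗ p2)
    (c := p1 ⊗ p2 ⊗ p1) (d := i2 ⊗ i2 ⊗ i1 ⊗ i2)); rewrite /Phi' /hχ.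
- strings (relation_rules, p2_braid_mul_Π2).
- strings (relation_rules, braid21r A m).
- strings (relation_rules, p2_braid_mul_Π2).
- strings (relation_rules, braid21r A m, braid21r B2 m).
Qed.

(** * The composites of a Hopf datum as components of B *)

Lemma fg_mul : m ∘ (i1 ⊗ m ∘ (i2 ⊗ 1)) ∘ ((p1 ⊗ p2) ∘ Δ ⊗ 1) = m.
Proof.
transitivity (m ∘ (m ∘ (i1 ⊗ i2) ∘ (p1 ⊗ p2) ∘ Δ ⊗ 1)); last by strings fg.
strings (mulA B).
Qed.

Lemma comul_fg : (1 ⊗ m ∘ (i1 ⊗ i2)) ∘ ((1 ⊗ p1) ∘ Δ ⊗ p2) ∘ Δ = Δ.
Proof.
transitivity ((1 ⊗ m ∘ (i1 ⊗ i2) ∘ (p1 ⊗ p2) ∘ Δ) ∘ Δ); last by strings fg.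
strings (comulA B).
Qed.

(** Splitting the second leg into its two parts produces the cycle [ρ], since
    [i2] is right [B2]-colinear; [cocycle_splits] is dual. *)
Lemma cycle_splits : (p1 ⊗ 1) ∘ Δ ∘ i2 = (id1 ⊗ f) ∘ (ρ ⊗ id2) ∘ Δ2.
Proof.
transitivity ((id1 ⊗ f) ∘ (p1 ⊗ p1 ⊗ id2) ∘ (Δ ⊗ id2) ∘ (1 ⊗ p2) ∘ Δ ∘ i2).
  strings (esym (comulA B), fg).
strings (p2_comul_i2, rz_ρ rz).
Qed.

Lemma cocycle_splits : p1 ∘ m ∘ (1 ⊗ i2) = m1 ∘ (id1 ⊗ σ) ∘ (g ⊗ id2).
Proof.
transitivity (p1 ∘ m ∘ (i1 ⊗ m ∘ (i2 ⊗ i2)) ∘ (g ⊗ id2)).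
  strings (esym (mulA B), fg).
strings (p1_mul_i1, rz_σ rz).
Qed.

Section TrivialCoaction.
Hypothesis S2 : (id2 ⊗ μr) ∘ (Ψ22 ⊗ id1) ∘ (id2 ⊗ νl) = η2 ⊗ μr.

Lemma coaction_trivial :
  (p2 ⊗ p2 ∘ m) ∘ (Ψ0 ⊗ 1) ∘ (1 ⊗ Δ ∘ i1) = η2 ⊗ p2 ∘ m ∘ (1 ⊗ i1).
Proof.
transitivity (((id2 ⊗ μr) ∘ (Ψ22 ⊗ id1) ∘ (id2 ⊗ νl)) ∘ (p2 ⊗ id1)).
  strings (component_rules, comul_i1_Π1, p2_mul_Π2, sink2).
rewrite S2; strings (component_rules, p2_mul_Π2).
Qed.

(** Splitting [a'] in [a' ⊗ p2 (x a'')] into its two parts leaves the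
    [Π2]-part next to [p2 (x a''')], where it is trivial. *)
Lemma drop_Π1_under_p2 :
  (1 ⊗ p2 ∘ m) ∘ (Ψ0 ⊗ 1) ∘ (1 ⊗ (Π1 ⊗ 1) ∘ Δ ∘ i1) =
  (1 ⊗ p2 ∘ m) ∘ (Ψ0 ⊗ 1) ∘ (1 ⊗ Δ ∘ i1).
Proof.
symmetry; transitivity ((f ⊗ id2) ∘
  (id1 ⊗ ((p2 ⊗ p2 ∘ m) ∘ (Ψ0 ⊗ 1) ∘ (1 ⊗ Δ ∘ i1))) ∘
  (Ψ [:: A] [:: B1] ⊗ id1) ∘ (1 ⊗ (p1 ⊗ p1) ∘ Δ ∘ i1)).
  strings (comul_i1_Π1, comulA B, fg, lift1, lift2, esym (braid21r A m)).
rewrite coaction_trivial; strings (i2_unit, mul1r B, comul_i1_Π1, lift1).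
Qed.

Lemma hφ21_realized : hφ21 h = g ∘ m ∘ (i2 ⊗ i1).
Proof.
rewrite /hφ21.
transitivity ((p1 ∘ m ⊗ p2 ∘ m) ∘ (1 ⊗ Ψ0 ⊗ 1) ∘
  (Δ ∘ i2 ⊗ (Π1 ⊗ 1) ∘ Δ ∘ i1)).
  strings (component_rules, Δ2_realized, comul_i2_Π2, comul_i1_Π1, p2_mul_Π2,
    lift1, sink2).
strings (comul_mul B, drop_Π1_under_p2).
Qed.

Section TrivialCycle.
Hypothesis S4 : (id1 ⊗ μr) ∘ (Ψ21 ⊗ μl) ∘ (id2 ⊗ Ψ21 ⊗ id1) ∘
  (id2 ⊗ id2 ⊗ ρ) = η1 ⊗ id2 ⊗ ε2 ⊗ ε2.

(** This is [hd_S4] with the unit [η2] as second argument. *)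
Lemma cycle_trivial :
  (id1 ⊗ p2 ∘ m) ∘ (Ψ [:: A] [:: B1] ⊗ i1) ∘ (1 ⊗ (p1 ⊗ p1) ∘ Δ ∘ i2) =
  η1 ⊗ p2 ⊗ ε2.
Proof.
transitivity (((id1 ⊗ μr) ∘ (Ψ21 ⊗ μl) ∘ (id2 ⊗ Ψ21 ⊗ id1) ∘ (id2 ⊗ id2 ⊗ ρ))
  ∘ (p2 ⊗ η2 ⊗ id2)).
  strings (component_rules, braid01l B1 η2, i2_unit, mul1l B, p1_i1, p2_mul_Π2,
    sink2).
rewrite S4; strings ε2_η2.
Qed.

Let Q := (p2 ⊗ p2 ∘ m) ∘ (Ψ0 ⊗ 1) ∘ (1 ⊗ Δ).

(** For [a] in [B1] and [b] in [B2], expanding [Δ (a b)] puts the coaction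
    of [a] next to [p2 (x a'')], where it is trivial. *)
Lemma coaction_trivial_f : Q ∘ (1 ⊗ f) = Q ∘ (i2 ∘ p2 ∘ m ∘ (1 ⊗ i1) ⊗ i2).
Proof.
transitivity ((p2 ∘ m ⊗ p2 ∘ m) ∘ (i2 ⊗ 1 ⊗ i2 ⊗ 1) ∘
  (id2 ⊗ Ψ [:: B2] [:: A] ⊗ 1) ∘
  (((p2 ⊗ p2 ∘ m) ∘ (Ψ0 ⊗ 1) ∘ (1 ⊗ Δ ∘ i1)) ⊗ Δ ∘ i2)).
  rewrite /Q.
  strings (comul_mul B, mulA B, p2_mul_Π2, sink2, braid21r A m, braid21l A m).
rewrite coaction_trivial /Q; strings (i2_unit, mul1l B, sink2, p2_mul_Π2).
Qed.

Lemma Δ2_counit : (ε2 ⊗ id2) ∘ Δ2 = id2.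
Proof. rewrite Δ2_realized; strings (p2_counit, comul1l B, p2_i2). Qed.

(** Now [c'] is split in [c' ⊗ p2 (x c'')] with [c] in [B2].  By
    [cycle_splits] the [Π1]-part and the rest come from the two legs of a
    cycle [ρ]; the coaction of the second leg disappears, and what remains is
    [cycle_trivial]. *)
Lemma drop_Π2_under_p2 :
  (1 ⊗ p2 ∘ m) ∘ (Ψ0 ⊗ 1) ∘ (1 ⊗ (Π2 ⊗ 1) ∘ Δ ∘ i2) =
  (1 ⊗ p2 ∘ m) ∘ (Ψ0 ⊗ 1) ∘ (1 ⊗ Δ ∘ i2).
Proof.
symmetry; transitivity ((f ⊗ id2) ∘ (id1 ⊗ Q) ∘ (Ψ [:: A] [:: B1] ⊗ 1) ∘
  (1 ⊗ (p1 ⊗ 1) ∘ Δ ∘ i2)).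
  rewrite /Q; strings (comulA B, fg, lift1, lift2, esym (braid21r A m)).
transitivity ((f ⊗ id2) ∘ (id1 ⊗ Q ∘ (1 ⊗ f)) ∘
  (Ψ [:: A] [:: B1] ⊗ id1 ⊗ id2) ∘ (1 ⊗ (ρ ⊗ id2) ∘ Δ2)).
  strings cycle_splits.
transitivity ((f ⊗ id2) ∘ (id1 ⊗ Q ∘ (i2 ⊗ 1)) ∘
  (((id1 ⊗ p2 ∘ m) ∘ (Ψ [:: A] [:: B1] ⊗ i1) ∘ (1 ⊗ (p1 ⊗ p1) ∘ Δ ∘ i2)) ⊗ i2)
  ∘ (1 ⊗ Δ2)).
  rewrite coaction_trivial_f; strings component_rules.
rewrite cycle_trivial /Q.
strings (Δ2_counit, i1_unit, mul1l B, p2_mul_Π2, sink2).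
Qed.

Lemma hσhat_realized : hσhat h = g ∘ m ∘ (i2 ⊗ i2).
Proof.
rewrite /hσhat /hα /hβ.
transitivity ((p1 ∘ m ⊗ p2 ∘ m) ∘ (1 ⊗ Ψ0 ⊗ 1) ∘
  (Δ ∘ i2 ⊗ (Π2 ⊗ 1) ∘ Δ ∘ i2)).
  strings (component_rules, Δ2_realized, comul_i2_Π2, esym (comulA B), mulA B,
    fg, p2_mul_Π2, sink2).
strings (comul_mul B, drop_Π2_under_p2).
Qed.

End TrivialCycle.
End TrivialCoaction.

(* The same arguments in the opposite category with the reversed tensor
   product, which exchanges multiplications with comultiplications, [i1] with
   [p2], [p1] with [i2] and [σ] with [ρ]. *)
Section TrivialAction.
Hypothesis S1 : (μr ⊗ id1) ∘ (id2 ⊗ Ψ11) ∘ (νl ⊗ id1) = νl ⊗ ε1.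

Lemma action_trivial :
  (p2 ∘ m ⊗ 1) ∘ (1 ⊗ Ψ0) ∘ (Δ ∘ i1 ⊗ i1) = (p2 ⊗ 1) ∘ Δ ∘ i1 ⊗ ε1.
Proof.
transitivity ((id2 ⊗ i1) ∘ ((μr ⊗ id1) ∘ (id2 ⊗ Ψ11) ∘ (νl ⊗ id1))).
  strings (component_rules, comul_i1_Π1, p2_mul_Π2, lift1).
rewrite S1; strings (component_rules, comul_i1_Π1).
Qed.

Lemma drop_Π2_over_i1 :
  (p2 ∘ m ∘ (1 ⊗ Π2) ⊗ 1) ∘ (1 ⊗ Ψ0) ∘ (Δ ∘ i1 ⊗ 1) =
  (p2 ∘ m ⊗ 1) ∘ (1 ⊗ Ψ0) ∘ (Δ ∘ i1 ⊗ 1).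
Proof.
symmetry; transitivity ((p2 ∘ m ∘ (i2 ⊗ i2) ⊗ 1) ∘ (id2 ⊗ Ψ [:: A] [:: B2]) ∘
  (((p2 ∘ m ⊗ 1) ∘ (1 ⊗ Ψ0) ∘ (Δ ∘ i1 ⊗ i1)) ⊗ id2) ∘ (id1 ⊗ g)).
  strings (p2_mul_Π2, mulA B, fg, sink1, sink2, esym (braid12r A Δ)).
rewrite action_trivial; strings (p1_counit, comul1l B, p2_mul_Π2, sink2).
Qed.

Lemma hφ12_realized : hφ12 h = (p2 ⊗ p1) ∘ Δ ∘ f.
Proof.
rewrite /hφ12.
transitivity ((p2 ∘ m ∘ (1 ⊗ Π2) ⊗ p1 ∘ m) ∘ (1 ⊗ Ψ0 ⊗ 1) ∘
  (Δ ∘ i1 ⊗ Δ ∘ i2)).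
  strings (component_rules, m1_realized, p1_mul_Π1, comul_i1_Π1, p2_mul_Π2,
    lift1, sink2).
strings (comul_mul B, drop_Π2_over_i1).
Qed.

Section TrivialCocycle.
Hypothesis S3 : (σ ⊗ id1 ⊗ id1) ∘ (id2 ⊗ Ψ12 ⊗ id1) ∘ (νr ⊗ Ψ12) ∘
  (νl ⊗ id2) = η1 ⊗ η1 ⊗ id1 ⊗ ε2.

Lemma cocycle_trivial :
  (p1 ∘ m ∘ (i2 ⊗ i2) ⊗ 1) ∘ (p2 ⊗ Ψ [:: A] [:: B2]) ∘ (Δ ∘ i1 ⊗ id2) =
  η1 ⊗ i1 ⊗ ε2.
Proof.
transitivity ((id1 ⊗ ε1 ⊗ i1) ∘
  ((σ ⊗ id1 ⊗ id1) ∘ (id2 ⊗ Ψ12 ⊗ id1) ∘ (νr ⊗ Ψ12) ∘ (νl ⊗ id2))).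
  strings (component_rules, braid10l B2 ε1, p1_counit, comul1r B, p2_i2,
    comul_i1_Π1, lift1).
rewrite S3; strings ε1_η1.
Qed.

Let Q := (m ⊗ 1) ∘ (1 ⊗ Ψ0) ∘ (Δ ∘ i1 ⊗ i1).

Lemma action_trivial_g : (g ⊗ 1) ∘ Q = (p1 ⊗ (p2 ⊗ 1) ∘ Δ ∘ i1 ∘ p1) ∘ Q.
Proof.
transitivity ((p1 ∘ m ⊗ ((p2 ∘ m ⊗ 1) ∘ (1 ⊗ Ψ0) ∘ (Δ ∘ i1 ⊗ i1))) ∘
  (1 ⊗ Ψ [:: B1] [:: A] ⊗ id1) ∘ (1 ⊗ p1 ⊗ 1 ⊗ p1) ∘ (Δ ∘ i1 ⊗ Δ ∘ i1)).
  rewrite /Q.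
  strings (comul_mul B, comulA B, comul_i1_Π1, lift1, braid12r A Δ, braid12l A Δ).
rewrite action_trivial /Q; strings (p1_counit, comul1r B, comul_i1_Π1, lift1).
Qed.

Lemma drop_Π1_over_i1 :
  (p1 ∘ m ∘ (1 ⊗ Π1) ⊗ 1) ∘ (1 ⊗ Ψ0) ∘ (Δ ∘ i1 ⊗ 1) =
  (p1 ∘ m ⊗ 1) ∘ (1 ⊗ Ψ0) ∘ (Δ ∘ i1 ⊗ 1).
Proof.
symmetry; transitivity ((p1 ∘ m ∘ (1 ⊗ i2) ⊗ 1) ∘ (1 ⊗ Ψ [:: A] [:: B2]) ∘
  (Q ⊗ id2) ∘ (id1 ⊗ g)).
  rewrite /Q; strings (mulA B, fg, sink1, sink2, esym (braid12r A Δ)).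
transitivity ((m1 ∘ (id1 ⊗ σ) ⊗ 1) ∘ (id1 ⊗ id2 ⊗ Ψ [:: A] [:: B2]) ∘
  (((g ⊗ 1) ∘ Q) ⊗ id2) ∘ (id1 ⊗ g)).
  strings cocycle_splits.
transitivity ((m1 ⊗ 1) ∘
  (p1 ⊗ ((p1 ∘ m ∘ (i2 ⊗ i2) ⊗ 1) ∘ (p2 ⊗ Ψ [:: A] [:: B2]) ∘ (Δ ∘ i1 ⊗ id2)))
  ∘ (((1 ⊗ p1) ∘ Q) ⊗ id2) ∘ (id1 ⊗ g)).
  rewrite action_trivial_g; strings component_rules.
rewrite cocycle_trivial /Q.
strings (m1_realized, i1_unit, mul1r B, p1_i1, p2_counit, comul1r B,
  comul_i1_Π1, lift1).
Qed.

Lemma hρhat_realized : hρhat h = (p1 ⊗ p1) ∘ Δ ∘ f.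
Proof.
rewrite /hρhat /hλ /hζ.
transitivity ((p1 ∘ m ∘ (1 ⊗ Π1) ⊗ p1 ∘ m) ∘ (1 ⊗ Ψ0 ⊗ 1) ∘
  (Δ ∘ i1 ⊗ Δ ∘ i2)).
  strings (component_rules, m1_realized, p1_mul_Π1, comulA B, esym (mulA B), fg,
    comul_i1_Π1, lift1).
strings (comul_mul B, drop_Π1_over_i1).
Qed.

End TrivialCocycle.
End TrivialAction.

(** * The Hopf datum of a bialgebra with strong projections *)

Section Datum.
Hypothesis S1 : (μr ⊗ id1) ∘ (id2 ⊗ Ψ11) ∘ (νl ⊗ id1) = νl ⊗ ε1.
Hypothesis S2 : (id2 ⊗ μr) ∘ (Ψ22 ⊗ id1) ∘ (id2 ⊗ νl) = η2 ⊗ μr.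
Hypothesis S3 : (σ ⊗ id1 ⊗ id1) ∘ (id2 ⊗ Ψ12 ⊗ id1) ∘ (νr ⊗ Ψ12) ∘
  (νl ⊗ id2) = η1 ⊗ η1 ⊗ id1 ⊗ ε2.
Hypothesis S4 : (id1 ⊗ μr) ∘ (Ψ21 ⊗ μl) ∘ (id2 ⊗ Ψ21 ⊗ id1) ∘
  (id2 ⊗ id2 ⊗ ρ) = η1 ⊗ id2 ⊗ ε2 ⊗ ε2.
Hypothesis S5 : (σ ⊗ id1) ∘ (id2 ⊗ νl) = η1 ∘ ε2 ⊗ id1.
Hypothesis S6 : (μr ⊗ id1) ∘ (id2 ⊗ ρ) = id2 ⊗ η1 ∘ ε2.

Let φ21E := hφ21_realized S2.
Let φ12E := hφ12_realized S1.
Let σhatE := hσhat_realized S2 S4.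
Let ρhatE := hρhat_realized S1 S3.

Lemma cocycle_coaction_trivial :
  (p1 ∘ m ⊗ 1) ∘ (1 ⊗ (Π2 ⊗ 1) ∘ Δ ∘ i1) = p1 ⊗ i1.
Proof.
transitivity ((m1 ⊗ i1) ∘ (id1 ⊗ ((σ ⊗ id1) ∘ (id2 ⊗ νl))) ∘ (g ⊗ id1)).
  strings (rz_σ rz, rz_νl rz, esym p1_mul_i1, mulA B, fg_mul, comul_i1_Π1).
rewrite S5; strings (m1_realized, i1_unit, p2_counit, comul1r B, mul1r B, p1_i1).
Qed.

(** The [Π2]-part that is dropped is a coaction [νl], and it enters the cocycle
    [σ] next to the element it comes from: this is trivial by [hd_S5]. *)
Lemma drop_Π1_under_p1 :
  (p1 ∘ m ⊗ 1) ∘ (1 ⊗ (Π1 ⊗ 1) ∘ Δ ∘ i1) = (p1 ∘ m ⊗ 1) ∘ (1 ⊗ Δ ∘ i1).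
Proof.
symmetry; transitivity (((p1 ∘ m ⊗ 1) ∘ (1 ⊗ (Π2 ⊗ 1) ∘ Δ ∘ i1)) ∘
  (m ⊗ id1) ∘ (1 ⊗ (Π1 ⊗ p1) ∘ Δ ∘ i1)).
  strings (comul_i1_Π1, comulA B, mulA B, fg).
rewrite cocycle_coaction_trivial; strings comul_i1_Π1.
Qed.

Lemma action_cycle_trivial :
  (p2 ∘ m ⊗ 1) ∘ (1 ⊗ (Π1 ⊗ 1) ∘ Δ ∘ i2) = p2 ⊗ i2.
Proof.
transitivity ((id2 ⊗ f) ∘ (((μr ⊗ id1) ∘ (id2 ⊗ ρ)) ⊗ id2) ∘ (p2 ⊗ Δ2)).
  strings (rz_μr rz, p2_mul_Π2, cycle_splits).
rewrite S6; strings (i1_unit, mul1l B, Δ2_realized, p2_counit, comul1l B, p2_i2).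
Qed.

(** Unlike in [drop_Π2_under_p2], the [Π1]-part that is dropped acts by [μr]
    itself: it is the first leg of a cycle, trivial by [hd_S6]. *)
Lemma drop_Π2_under_p2' :
  (p2 ∘ m ⊗ 1) ∘ (1 ⊗ (Π2 ⊗ 1) ∘ Δ ∘ i2) = (p2 ∘ m ⊗ 1) ∘ (1 ⊗ Δ ∘ i2).
Proof.
symmetry; transitivity ((p2 ∘ m ⊗ 1) ∘ (i2 ⊗ (i2 ∘ p2 ⊗ 1) ∘ Δ) ∘
  ((p2 ∘ m ⊗ 1) ∘ (1 ⊗ (Π1 ⊗ 1) ∘ Δ ∘ i2))).
  strings (p2_mul_Π2, comulA B, mulA B, fg).
rewrite action_cycle_trivial; strings p2_mul_Π2.
Qed.

(** In the algebra-coalgebra condition a strand passes between the two legs of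
    [Δ].  Letting it pass the second leg too puts [drop_Π1_under_p1] at work,
    and the additional crossing is undone since the braiding is invertible. *)
Lemma braided_drop_Π1 :
  (p1 ∘ m ⊗ 1 ⊗ 1) ∘ (1 ⊗ Ψ0 ⊗ 1) ∘ (1 ⊗ 1 ⊗ (Π1 ⊗ 1) ∘ Δ ∘ i1) =
  (p1 ∘ m ⊗ 1 ⊗ 1) ∘ (1 ⊗ Ψ0 ⊗ 1) ∘ (1 ⊗ 1 ⊗ Δ ∘ i1).
Proof.
have [k kΨ] := wbraid_inv A.
transitivity ((id1 ⊗ k) ∘
  (((p1 ∘ m ⊗ 1) ∘ (1 ⊗ (Π1 ⊗ 1) ∘ Δ ∘ i1)) ⊗ 1) ∘ (1 ⊗ Ψ [:: A] [:: B1])).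
  strings (lift1, braid12r A Δ, kΨ).
rewrite drop_Π1_under_p1; strings (lift1, braid12r A Δ, kΨ).
Qed.

Lemma braided_drop_Π2 :
  (p2 ∘ m ⊗ 1 ⊗ 1) ∘ (1 ⊗ Ψ0 ⊗ 1) ∘ (1 ⊗ 1 ⊗ (Π2 ⊗ 1) ∘ Δ ∘ i2) =
  (p2 ∘ m ⊗ 1 ⊗ 1) ∘ (1 ⊗ Ψ0 ⊗ 1) ∘ (1 ⊗ 1 ⊗ Δ ∘ i2).
Proof.
have [k kΨ] := wbraid_inv A.
transitivity ((id2 ⊗ k) ∘
  (((p2 ∘ m ⊗ 1) ∘ (1 ⊗ (Π2 ⊗ 1) ∘ Δ ∘ i2)) ⊗ 1) ∘ (1 ⊗ Ψ [:: A] [:: B2])).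
  strings (lift2, braid12r A Δ, kΨ).
rewrite drop_Π2_under_p2'; strings (lift2, braid12r A Δ, kΨ).
Qed.

Lemma realized_algebra : is_algebra m1 η1.
Proof.
split.
- transitivity (p1 ∘ i1 ∘ m1 ∘ (m1 ⊗ id1)); first by strings p1_i1.
  transitivity (p1 ∘ i1 ∘ m1 ∘ (id1 ⊗ m1)); last by strings p1_i1.
  strings (i1_mul, mulA B).
- strings (m1_realized, i1_unit, mul1l B, p1_i1).
- strings (m1_realized, i1_unit, mul1r B, p1_i1).
Qed.

Lemma realized_coalgebra : is_coalgebra Δ2 ε2.
Proof.
split.
- transitivity ((Δ2 ⊗ id2) ∘ Δ2 ∘ p2 ∘ i2); first by strings p2_i2.
  transitivity ((id2 ⊗ Δ2) ∘ Δ2 ∘ p2 ∘ i2); last by strings p2_i2.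
  strings (p2_comul, comulA B).
- exact: Δ2_counit.
- strings (Δ2_realized, p2_counit, comul1r B, p2_i2).
Qed.

(* As single boxes, [f] and [g] pass a crossing in one rewriting step. *)
Definition join := f.
Definition cut := g.

Lemma join_cut : join ∘ cut = 1.
Proof. rewrite /join /cut; strings fg. Qed.

Lemma hα_realized : hα h = p2 ∘ m ∘ (i2 ⊗ join).
Proof. rewrite /hα /join; strings (component_rules, p2_mul_Π2, mulA B). Qed.

Lemma hλ_realized : hλ h = p1 ∘ m ∘ (join ⊗ i1).
Proof.
rewrite /hλ /join; strings (component_rules, m1_realized, p1_mul_Π1, mulA B).
Qed.

Lemma hβ_realized : hβ h = (p2 ⊗ cut) ∘ Δ ∘ i2.
Proof.
rewrite /hβ /cut; strings (component_rules, Δ2_realized, comul_i2_Π2, comulA B).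
Qed.

Lemma hζ_realized : hζ h = (cut ⊗ p1) ∘ Δ ∘ i1.
Proof. rewrite /hζ /cut; strings (component_rules, comul_i1_Π1, comulA B). Qed.

Let B1_linear_rules := (mul_i1_Π1, esym p1_mul_i1, i1_mul, mulA B, fg_mul, fg).
Let B2_colinear_rules := (p2_comul, comulA B, comul_fg, fg, esym p2_comul_i2).

Lemma hκ_realized : hκ h = p1 ∘ m ∘ (join ⊗ join).
Proof. rewrite /hκ /join; strings (φ21E, rz_σ rz, B1_linear_rules). Qed.

Lemma hω_realized : hω h = (cut ⊗ cut) ∘ Δ ∘ i2.
Proof. rewrite /hω /cut; strings (φ12E, rz_ρ rz, B2_colinear_rules). Qed.

Local Notation Θ := (Ψ [:: B1; B2] [:: B1; B2]).

Let composite_rules :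
  ((hα h = p2 ∘ m ∘ (i2 ⊗ join)) * (hλ h = p1 ∘ m ∘ (join ⊗ i1)) *
   (hβ h = (p2 ⊗ cut) ∘ Δ ∘ i2) * (hζ h = (cut ⊗ p1) ∘ Δ ∘ i1) *
   (hκ h = p1 ∘ m ∘ (join ⊗ join)) * (hω h = (cut ⊗ cut) ∘ Δ ∘ i2)) *
  ((hφ21 h = cut ∘ m ∘ (i2 ⊗ i1)) * (hφ12 h = (p2 ⊗ p1) ∘ Δ ∘ join) *
   (hσhat h = cut ∘ m ∘ (i2 ⊗ i2)) * (hρhat h = (p1 ⊗ p1) ∘ Δ ∘ join)) *
  ((join ∘ cut = 1) * (Θ ∘ (cut ⊗ cut) = (cut ⊗ cut) ∘ Ψ0) *
   (Ψ [:: B1] [:: B1; B2] ∘ (id1 ⊗ cut) = (cut ⊗ id1) ∘ Ψ [:: B1] [:: A]) *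
   (Ψ [:: B2] [:: B1; B2] ∘ (id2 ⊗ cut) = (cut ⊗ id2) ∘ Ψ [:: B2] [:: A])).
Proof.
split; [split|].
- do !split; [exact: hα_realized | exact: hλ_realized | exact: hβ_realized
    | exact: hζ_realized | exact: hκ_realized | exact: hω_realized].
- by rewrite φ21E φ12E σhatE ρhatE.
- by do !split; [exact: join_cut | exact: wbraid_natural | exact: wbraid_natural
    | exact: wbraid_natural].
Qed.

Lemma realized_algebra_coalgebra1 : Δ1 ∘ m1 =
  (hλ h ⊗ m1) ∘ (wid [:: B1; B2] ⊗ Ψ11 ⊗ id1) ∘ (hζ h ⊗ Δ1).
Proof.
transitivity ((p1 ∘ m ⊗ p1 ∘ m) ∘ (1 ⊗ Ψ0 ⊗ 1) ∘
  (Δ ∘ i1 ⊗ (Π1 ⊗ 1) ∘ Δ ∘ i1)).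
  strings (rz_Δ1 rz, i1_mul, comul_mul B, braided_drop_Π1).
strings (composite_rules, rz_Δ1 rz, m1_realized, comul_i1_Π1, lift1).
Qed.

Lemma realized_algebra_coalgebra2 : Δ2 ∘ m2 =
  (m2 ⊗ hα h) ∘ (id2 ⊗ Ψ22 ⊗ wid [:: B1; B2]) ∘ (Δ2 ⊗ hβ h).
Proof.
transitivity ((p2 ∘ m ⊗ p2 ∘ m) ∘ (1 ⊗ Ψ0 ⊗ 1) ∘
  (Δ ∘ i2 ⊗ (Π2 ⊗ 1) ∘ Δ ∘ i2)).
  strings (rz_m2 rz, p2_comul, comul_mul B, braided_drop_Π2).
strings (composite_rules, rz_m2 rz, Δ2_realized, p2_mul_Π2, sink2).
Qed.

Let counit_rules := (component_rules, unit_rules, mul1l B, mul1r B, comul1l B,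
  comul1r B, comul_unit B, counit_mul B, counit_unit B).

Lemma realized_hopf_datum : is_hopf_datum h.
Proof.
split.
7-28: strings counit_rules.
- exact: realized_algebra.
- by split; rewrite /unit_mul /unit_unit; strings (ε1_m1, ε1_η1).
- exact: realized_coalgebra.
- by split; rewrite /unit_comul /unit_counit; strings (Δ2_η2, ε2_η2).
- by split; strings (rz_νl rz, p2_comul, comulA B, comul_i1_Π1, p2_counit,
    comul1l B, p1_i1).
- by split; strings (rz_μr rz, i1_mul, esym (mulA B), p2_mul_Π2, i1_unit,
    mul1r B, p2_i2).
- strings (σhatE, component_rules, p2_mul_Π2, mulA B, fg).
- strings (ρhatE, component_rules, comul_i1_Π1, comulA B, fg).
- strings (σhatE, φ21E, rz_μl rz, rz_σ rz, B1_linear_rules).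
- strings (ρhatE, φ12E, rz_ρ rz, rz_νr rz, B2_colinear_rules).
- strings (φ21E, rz_μl rz, B1_linear_rules).
- strings (φ21E, rz_μr rz, rz_m2 rz, p2_mul_Π2, mulA B, fg).
- strings (φ12E, component_rules, comul_i1_Π1, comulA B, fg).
- strings (φ12E, rz_νr rz, B2_colinear_rules).
- strings (σhatE, φ21E, rz_σ rz, B1_linear_rules).
- strings (ρhatE, φ12E, rz_ρ rz, B2_colinear_rules).
- exact: realized_algebra_coalgebra1.
- exact: realized_algebra_coalgebra2.
- strings (composite_rules, comul_mul B, comul_i1_Π1).
- strings (rz_μr rz, p2_comul, composite_rules, Δ2_realized, comul_mul B,
    comul_i1_Π1, p2_mul_Π2, sink2).
- strings (rz_νl rz, i1_mul, composite_rules, m1_realized, comul_mul B,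
    comul_i1_Π1, p2_mul_Π2, lift1, sink2).
- strings (composite_rules, comul_mul B, p2_mul_Π2).
- strings (composite_rules, comul_mul B, comul_i1_Π1, p2_mul_Π2).
- strings (composite_rules, comul_mul B).
Qed.

Lemma cross_product_isomorphic : bialgebra_isomorphic (cross_product h) B.
Proof.
exists f, g; split.
- have gf' : g ∘ f = wid [:: B1; B2] by strings gf.
  have fg' : f ∘ g = 1 by strings fg.
  by split.
- split; last by rewrite /=; strings (i1_unit, i2_unit, mul1l B).
  by rewrite /=; strings (φ21E, σhatE, i1_mul, mulA B, fg_mul, fg).
- split; last by rewrite /=; strings (counit_mul B, i1_counit, i2_counit).
  (* Precomposed with [g], both sides are iterated comultiplications of [B]. *)
  symmetry; transitivity ((f ⊗ f) ∘ bcomul (cross_product h) ∘ g ∘ f).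
    by strings gf.
  by rewrite /=; strings (φ12E, ρhatE, p2_comul, comulA B, comul_fg, fg).
Qed.

End Datum.

(** * Idempotents from projections *)

Lemma realized_idempotents :
  [/\ m ∘ (Π1 ⊗ Π1) = Π1 ∘ m ∘ (Π1 ⊗ Π1),
      Π1 ∘ η = η,
      (Π2 ⊗ Π2) ∘ Δ = (Π2 ⊗ Π2) ∘ Δ ∘ Π2
    & ε ∘ Π2 = ε] /\
  split_by (Π1 ⊗ Π2) (m ∘ (Π1 ⊗ Π2)) ((Π1 ⊗ Π2) ∘ Δ).
Proof.
split.
  split; [strings (mul_i1_Π1, p1_i1) | strings (p1_unit, i1_unit)
    | strings (esym p2_comul, p2_i2) | strings (i2_counit, p2_counit)].
have pi : (m ∘ (Π1 ⊗ Π2)) ∘ ((Π1 ⊗ Π2) ∘ Δ) = 1 by strings (p1_i1, p2_i2, fg).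
have ip : ((Π1 ⊗ Π2) ∘ Δ) ∘ (m ∘ (Π1 ⊗ Π2)) = Π1 ⊗ Π2 by strings gf.
by split.
Qed.

End Realization.

(** * The projections of a cross product *)

Section CrossProduct.
Context (C : strict_braided) (h : hopf_maps C).
Hypothesis hd : is_hopf_datum h.
Local Notation B1 := (hB1 h).
Local Notation B2 := (hB2 h).
Local Notation m1 := (hm1 h).
Local Notation m2 := (hm2 h).
Local Notation η1 := (hη1 h).
Local Notation η2 := (hη2 h).
Local Notation Δ1 := (hΔ1 h).
Local Notation Δ2 := (hΔ2 h).
Local Notation ε1 := (hε1 h).
Local Notation ε2 := (hε2 h).
Local Notation id1 := (wid [:: B1]).
Local Notation id2 := (wid [:: B2]).
Local Notation mX := (bmul (cross_product h)).
Local Notation ΔX := (bcomul (cross_product h)).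

Lemma hd_m1_unit : (m1 ∘ (η1 ⊗ id1) = id1) * (m1 ∘ (id1 ⊗ η1) = id1).
Proof. by case: (hd_algebra1 hd). Qed.

Lemma hd_Δ2_counit : ((ε2 ⊗ id2) ∘ Δ2 = id2) * ((id2 ⊗ ε2) ∘ Δ2 = id2).
Proof. by case: (hd_coalgebra2 hd). Qed.

Lemma hd_ε1_alg : (ε1 ∘ m1 = ε1 ⊗ ε1) * (ε1 ∘ η1 = wid [::]).
Proof. case: (hd_counit1 hd) => a b; split=> //; rewrite a /unit_mul; strings. Qed.

Lemma hd_η2_coalg : (Δ2 ∘ η2 = η2 ⊗ η2) * (ε2 ∘ η2 = wid [::]).
Proof. case: (hd_unit2 hd) => a b; split=> //; rewrite a /unit_comul; strings. Qed.

Lemma hd_νl_counit : (ε2 ⊗ id1) ∘ hνl h = id1.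
Proof. by case: (hd_comodule hd). Qed.

Lemma hd_μr_unit : hμr h ∘ (id2 ⊗ η1) = id2.
Proof. by case: (hd_module hd). Qed.

Let counits := (hd_m1_unit, hd_Δ2_counit, hd_ε1_alg, hd_η2_coalg,
  hd_νl_counit, hd_μr_unit,
  (hd_Δ1_η1 hd, hd_Δ1_ε1r hd, hd_Δ1_ε1l hd, hd_ε2_m2 hd,
   hd_m2_η2r hd, hd_m2_η2l hd, hd_μr_η2 hd, hd_ε2_μr hd, hd_ε1_νl hd,
   hd_νl_η1 hd, hd_μl_η2 hd, hd_μl_η1 hd, hd_ε1_μl hd, hd_ε1_νr hd,
   hd_ε2_νr hd, hd_νr_η2 hd, hd_σ_η2l hd, hd_σ_η2r hd, hd_ε1_σ hd,
   hd_ε1_ρr hd, hd_ε1_ρl hd, hd_ρ_η2 hd),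
  (braid01l B1 η2, braid01r B1 η2, braid01l B2 η2, braid01r B2 η2,
   braid01l B1 η1, braid01r B1 η1, braid01l B2 η1, braid01r B2 η1,
   braid10l B1 ε2, braid10r B1 ε2, braid10l B2 ε2, braid10r B2 ε2,
   braid10l B1 ε1, braid10r B1 ε1, braid10l B2 ε1, braid10r B2 ε1)).

Lemma mX_11 : mX ∘ (id1 ⊗ η2 ⊗ (id1 ⊗ η2)) = m1 ⊗ η2.
Proof. rewrite /= /hφ21 /hσhat /hα /hβ; strings counits. Qed.

Lemma mX_12 : mX ∘ (id1 ⊗ η2 ⊗ (η1 ⊗ id2)) = id1 ⊗ id2.
Proof. rewrite /= /hφ21 /hσhat /hα /hβ; strings counits. Qed.

Lemma mX_21 : mX ∘ (η1 ⊗ id2 ⊗ (id1 ⊗ η2)) = hφ21 h.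
Proof. rewrite /= /hσhat /hα /hβ; strings counits. Qed.

Lemma mX_22 : mX ∘ (η1 ⊗ id2 ⊗ (η1 ⊗ id2)) = hσhat h.
Proof. rewrite /= /hφ21; strings counits. Qed.

Lemma ΔX_22 : (ε1 ⊗ id2 ⊗ (ε1 ⊗ id2)) ∘ ΔX = ε1 ⊗ Δ2.
Proof. rewrite /= /hφ12 /hρhat /hλ /hζ; strings counits. Qed.

Lemma ΔX_12 : (id1 ⊗ ε2 ⊗ (ε1 ⊗ id2)) ∘ ΔX = id1 ⊗ id2.
Proof. rewrite /= /hφ12 /hρhat /hλ /hζ; strings counits. Qed.

Lemma ΔX_21 : (ε1 ⊗ id2 ⊗ (id1 ⊗ ε2)) ∘ ΔX = hφ12 h.
Proof. rewrite /= /hρhat /hλ /hζ; strings counits. Qed.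

Lemma ΔX_11 : (id1 ⊗ ε2 ⊗ (id1 ⊗ ε2)) ∘ ΔX = hρhat h.
Proof. rewrite /= /hφ12; strings counits. Qed.

Lemma φ21_parts :
  ((id1 ⊗ ε2) ∘ hφ21 h = hμl h) * ((ε1 ⊗ id2) ∘ hφ21 h = hμr h).
Proof. rewrite /hφ21; split; strings counits. Qed.

Lemma σhat_parts :
  ((id1 ⊗ ε2) ∘ hσhat h = hσ h) * ((ε1 ⊗ id2) ∘ hσhat h = m2).
Proof. rewrite /hσhat /hα /hβ; split; strings counits. Qed.

Lemma φ12_parts :
  (hφ12 h ∘ (id1 ⊗ η2) = hνl h) * (hφ12 h ∘ (η1 ⊗ id2) = hνr h).
Proof. rewrite /hφ12; split; strings counits. Qed.

Lemma ρhat_parts :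
  (hρhat h ∘ (id1 ⊗ η2) = Δ1) * (hρhat h ∘ (η1 ⊗ id2) = hρ h).
Proof. rewrite /hρhat /hλ /hζ; split; strings counits. Qed.

Context (B : bialgebra C).
Context (F : [:: B1; B2] --> [:: bobj B]) (G : [:: bobj B] --> [:: B1; B2]).
Local Notation m := (bmul B).
Local Notation Δ := (bcomul B).
Hypothesis GF : G ∘ F = wid [:: B1; B2].
Hypothesis FG : F ∘ G = wid [:: bobj B].
Hypothesis F_mul : F ∘ mX = m ∘ (F ⊗ F).
Hypothesis F_unit : F ∘ (η1 ⊗ η2) = bunit B.
Hypothesis F_comul : Δ ∘ F = (F ⊗ F) ∘ ΔX.
Hypothesis F_counit : bcounit B ∘ F = ε1 ⊗ ε2.

Lemma G_comul : (G ⊗ G) ∘ Δ = ΔX ∘ G.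
Proof.
transitivity ((G ⊗ G) ∘ (Δ ∘ F) ∘ G); first by strings FG.
rewrite F_comul; strings GF.
Qed.

Lemma G_counit : (ε1 ⊗ ε2) ∘ G = bcounit B.
Proof. rewrite -F_counit; strings FG. Qed.

Lemma G_unit : G ∘ bunit B = η1 ⊗ η2.
Proof. rewrite -F_unit; strings GF. Qed.

(** Every requirement concerns a component of [mX] or [ΔX], and those are read
    off above. *)
Lemma cross_product_realized : @realized C B h
  (F ∘ (id1 ⊗ η2)) ((id1 ⊗ ε2) ∘ G) (F ∘ (η1 ⊗ id2)) ((ε1 ⊗ id2) ∘ G).
Proof.
split.
- strings (esym F_mul, mX_11).
- strings F_unit.
- strings (G_comul, ΔX_22).
- strings G_counit.
- strings (GF, hd_η2_coalg).
- strings (GF, hd_ε1_alg).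
- strings (G_comul, esym F_mul, GF, mX_12, ΔX_12).
- strings (G_comul, esym F_mul, FG, mX_12, ΔX_12).
- strings (G_comul, GF, ΔX_11, ρhat_parts).
- strings (F_counit, hd_η2_coalg).
- strings (esym F_mul, GF, mX_22, σhat_parts).
- strings (G_unit, hd_ε1_alg).
- strings (esym F_mul, GF, mX_21, φ21_parts).
- strings (esym F_mul, GF, mX_21, φ21_parts).
- strings (G_comul, GF, ΔX_21, φ12_parts).
- strings (G_comul, GF, ΔX_21, φ12_parts).
- strings (G_comul, GF, ΔX_11, ρhat_parts).
- strings (esym F_mul, GF, mX_22, σhat_parts).
Qed.

End CrossProduct.

(** * The equivalence *)

Lemma realized_strong_datum (C : strict_braided) (B : bialgebra C)
    (h : hopf_maps C) i1 p1 i2 p2 : @realized C B h i1 p1 i2 p2 ->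
  strong_projection_relations (i1 ∘ p1) (i2 ∘ p2) ->
  is_strong_hopf_datum h /\ bialgebra_isomorphic (cross_product h) B.
Proof.
move=> rz [P1 P1' P2 P2' P3 P3' P4 P4'].
have S1 := (rel_P1_S1 rz).1 P1; have S2 := (rel_P1'_S2 rz).1 P1'.
have S3 := (rel_P2_S3 rz).1 P2; have S4 := (rel_P2'_S4 rz).1 P2'.
have S5 := (rel_P3_S5 rz).1 P3; have S6 := (rel_P3'_S6 rz).1 P3'.
split; last exact: cross_product_isomorphic rz S1 S2 S3 S4.
split=> //; first exact: realized_hopf_datum rz S1 S2 S3 S4 S5 S6.
- exact: (rel_P4_S7 rz).1.
- exact: (rel_P4'_S8 rz).1.
Qed.

Lemma realized_strong_relations (C : strict_braided) (B : bialgebra C)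
    (h : hopf_maps C) i1 p1 i2 p2 : @realized C B h i1 p1 i2 p2 ->
  is_strong_hopf_datum h -> strong_projection_relations (i1 ∘ p1) (i2 ∘ p2).
Proof.
move=> rz [_ S1 S2 S3 S4 S5 S6 S7 S8]; split.
- exact: (rel_P1_S1 rz).2.
- exact: (rel_P1'_S2 rz).2.
- exact: (rel_P2_S3 rz).2.
- exact: (rel_P2'_S4 rz).2.
- exact: (rel_P3_S5 rz).2.
- exact: (rel_P3'_S6 rz).2.
- exact: (rel_P4_S7 rz).2.
- exact: (rel_P4'_S8 rz).2.
Qed.

(** The condition on [Π1] makes its image a subalgebra, and the dual condition
    on [Π2] makes its image a quotient coalgebra. *)
Lemma split_projections (C : strict_braided) (B : bialgebra C) (B1 B2 : C)
    (i1 : [:: B1] --> [:: bobj B]) (p1 : [:: bobj B] --> [:: B1])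
    (i2 : [:: B2] --> [:: bobj B]) (p2 : [:: bobj B] --> [:: B2]) :
  p1 ∘ i1 = wid [:: B1] -> p2 ∘ i2 = wid [:: B2] ->
  bmul B ∘ (i1 ∘ p1 ⊗ i1 ∘ p1) = (i1 ∘ p1) ∘ bmul B ∘ (i1 ∘ p1 ⊗ i1 ∘ p1) ->
  (i1 ∘ p1) ∘ bunit B = bunit B ->
  (i2 ∘ p2 ⊗ i2 ∘ p2) ∘ bcomul B =
    (i2 ∘ p2 ⊗ i2 ∘ p2) ∘ bcomul B ∘ (i2 ∘ p2) ->
  bcounit B ∘ (i2 ∘ p2) = bcounit B ->
  let m1 := p1 ∘ bmul B ∘ (i1 ⊗ i1) in let η1 := p1 ∘ bunit B in
  let Δ2 := (p2 ⊗ p2) ∘ bcomul B ∘ i2 in let ε2 := bcounit B ∘ i2 in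
  [/\ is_algebra m1 η1, is_coalgebra Δ2 ε2,
      is_algebra_morphism (s := [:: B1]) m1 η1 (bmul B) (bunit B) i1
    & is_coalgebra_morphism (t := [:: B2]) (bcomul B) (bcounit B) Δ2 ε2 p2].
Proof.
move=> pi1 pi2 Hm Hu Hd He m1 η1 Δ2 ε2.
have Im : i1 ∘ p1 ∘ bmul B ∘ (i1 ⊗ i1) = bmul B ∘ (i1 ⊗ i1).
  transitivity (((i1 ∘ p1) ∘ bmul B ∘ (i1 ∘ p1 ⊗ i1 ∘ p1)) ∘ (i1 ⊗ i1)).
    by strings pi1.
  by rewrite -Hm; strings pi1.
have Id : (p2 ⊗ p2) ∘ bcomul B ∘ i2 ∘ p2 = (p2 ⊗ p2) ∘ bcomul B.
  transitivity ((p2 ⊗ p2) ∘ ((i2 ∘ p2 ⊗ i2 ∘ p2) ∘ bcomul B ∘ (i2 ∘ p2))).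
    by strings pi2.
  by rewrite -Hd; strings pi2.
split; split; rewrite /m1 /η1 /Δ2 /ε2.
- strings (Im, mulA B).
- strings (Hu, mul1l B, pi1).
- strings (Hu, mul1r B, pi1).
- strings (Id, comulA B).
- strings (He, comul1l B, pi2).
- strings (He, comul1r B, pi2).
- strings Im.
- strings Hu.
- strings Id.
- strings He.
Qed.

Theorem theorem4p5 (C : strict_braided) (C_split : idempotents_split C)
    (B : bialgebra C) :
  [<->
    (exists h : hopf_maps C,
       is_strong_hopf_datum h /\ bialgebra_isomorphic (cross_product h) B);

    (exists Π1 Π2 : [:: bobj B] --> [:: bobj B],
       (Π1 ∘ Π1 = Π1 /\ Π2 ∘ Π2 = Π2) /\
       [/\ bmul B ∘ (Π1 ⊗ Π1) = Π1 ∘ bmul B ∘ (Π1 ⊗ Π1),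
           Π1 ∘ bunit B = bunit B,
           (Π2 ⊗ Π2) ∘ bcomul B = (Π2 ⊗ Π2) ∘ bcomul B ∘ Π2
         & bcounit B ∘ Π2 = bcounit B] /\
       split_by (Π1 ⊗ Π2)
         (bmul B ∘ (Π1 ⊗ Π2)) ((Π1 ⊗ Π2) ∘ bcomul B) /\
       strong_projection_relations Π1 Π2);

    (exists (B1 : C) (m1 : [:: B1; B1] --> [:: B1]) (η1 : [::] --> [:: B1])
            (B2 : C) (Δ2 : [:: B2] --> [:: B2; B2]) (ε2 : [:: B2] --> [::])
            (i1 : [:: B1] --> [:: bobj B]) (p1 : [:: bobj B] --> [:: B1])
            (i2 : [:: B2] --> [:: bobj B]) (p2 : [:: bobj B] --> [:: B2]),
       (is_algebra m1 η1 /\ is_coalgebra Δ2 ε2) /\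
       is_algebra_morphism (s := [:: B1]) m1 η1 (bmul B) (bunit B) i1 /\
       is_coalgebra_morphism (t := [:: B2]) (bcomul B) (bcounit B) Δ2 ε2 p2 /\
       (p1 ∘ i1 = wid [:: B1] /\ p2 ∘ i2 = wid [:: B2]) /\
       mutually_inverse (bmul B ∘ (i1 ⊗ i2)) ((p1 ⊗ p2) ∘ bcomul B) /\
       strong_projection_relations (i1 ∘ p1) (i2 ∘ p2))
  ].
Proof.
tfae.
- case=> h [hs [F [G [[GF FG] [Fm Fu] [Fd Fe]]]]].
  have rz := cross_product_realized (strong_hopf_datum hs) GF FG Fm Fu Fd Fe.
  have [idem sp] := realized_idempotents rz.
  have [pi1 pi2] := (rz_p1_i1 rz, rz_p2_i2 rz).
  do 2 eexists; split; last first.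
    by split; [exact: idem | split; [exact: sp | exact: realized_strong_relations]].
  by split; [strings pi1 | strings pi2].
- case=> Π1 [Π2 [[idem1 idem2] [[Hm Hu Hd He] [[pi ip] rel]]]].
  have [B1 [p1 [i1 [pi1 e1]]]] : exists (B1 : C) (p1 : [:: bobj B] --> [:: B1])
      (i1 : [:: B1] --> [:: bobj B]), p1 ∘ i1 = wid [:: B1] /\ i1 ∘ p1 = Π1.
    exact: C_split idem1.
  have [B2 [p2 [i2 [pi2 e2]]]] : exists (B2 : C) (p2 : [:: bobj B] --> [:: B2])
      (i2 : [:: B2] --> [:: bobj B]), p2 ∘ i2 = wid [:: B2] /\ i2 ∘ p2 = Π2.
    exact: C_split idem2.
  subst Π1 Π2.
  have [alg coalg Hi1 Hp2] := split_projections pi1 pi2 Hm Hu Hd He.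
  exists B1, (p1 ∘ bmul B ∘ (i1 ⊗ i1)), (p1 ∘ bunit B).
  exists B2, ((p2 ⊗ p2) ∘ bcomul B ∘ i2), (bcounit B ∘ i2), i1, p1, i2, p2.
  have pi' : (bmul B ∘ (i1 ∘ p1 ⊗ i2 ∘ p2)) ∘ ((i1 ∘ p1 ⊗ i2 ∘ p2) ∘ bcomul B) =
    wid [:: bobj B] := pi.
  have ip' : ((i1 ∘ p1 ⊗ i2 ∘ p2) ∘ bcomul B) ∘ (bmul B ∘ (i1 ∘ p1 ⊗ i2 ∘ p2)) =
    i1 ∘ p1 ⊗ i2 ∘ p2 := ip.
  have fg : (bmul B ∘ (i1 ⊗ i2)) ∘ ((p1 ⊗ p2) ∘ bcomul B) = wid [:: bobj B].
    by rewrite -pi'; strings (pi1, pi2).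
  have gf : ((p1 ⊗ p2) ∘ bcomul B) ∘ (bmul B ∘ (i1 ⊗ i2)) = wid [:: B1; B2].
    transitivity ((p1 ⊗ p2) ∘ (((i1 ∘ p1 ⊗ i2 ∘ p2) ∘ bcomul B) ∘
        (bmul B ∘ (i1 ∘ p1 ⊗ i2 ∘ p2))) ∘ (i1 ⊗ i2)).
      by strings (pi1, pi2).
    by rewrite ip'; strings (pi1, pi2).
  by do !split=> //.
- case=> B1 [m1 [η1 [B2 [Δ2 [ε2 [i1 [p1 [i2 [p2 H]]]]]]]]].
  case: H => _ [[im iu] [[pd pe] [[pi1 pi2] [[gf fg] rel]]]].
  pose h := HopfMaps m1 η1 ((p1 ⊗ p1) ∘ bcomul B ∘ i1) (bcounit B ∘ i1)
    (p2 ∘ bmul B ∘ (i2 ⊗ i2)) (p2 ∘ bunit B) Δ2 ε2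
    (p1 ∘ bmul B ∘ (i2 ⊗ i1)) (p2 ∘ bmul B ∘ (i2 ⊗ i1))
    ((p2 ⊗ p1) ∘ bcomul B ∘ i1) ((p2 ⊗ p1) ∘ bcomul B ∘ i2)
    ((p1 ⊗ p1) ∘ bcomul B ∘ i2) (p1 ∘ bmul B ∘ (i2 ⊗ i2)).
  have gf' : ((p1 ⊗ p2) ∘ bcomul B) ∘ (bmul B ∘ (i1 ⊗ i2)) = wid [:: B1; B2].
    exact: gf.
  have fg' : (bmul B ∘ (i1 ⊗ i2)) ∘ ((p1 ⊗ p2) ∘ bcomul B) = wid [:: bobj B].
    exact: fg.
  have rz : @realized C B h i1 p1 i2 p2.
    by split=> //=; [strings gf' | strings fg'].
  by exists h; exact: realized_strong_datum rz rel.
Qed.
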